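(* Let $n>p>1$ and $F(u)=\frac{1}{2n}|1-u^2|^n$. Let $N\in\mathbb{N}$ and let $v:(a,b)\to\{-1,+1\}$ be a piecewise constant function with exactly $N$ discontinuities, located at $a<h_1<h_2<\dots<h_N<b$. Define the sequence $(k_m)_{m\ge1}$ by $$k_1=0,\qquad k_2=\alpha,\qquad k_{m+1}=\alpha(k_m+1)\ \text{ for } m\ge2,\qquad\text{where }\alpha:=\frac{p-1}{p}+\frac1n.$$ Then, for any $m\in\mathbb{N}$, $m\ge1$, there exist constants $\delta_m>0$ and $C_m>0$ such that, for all sufficiently small $\varepsilon>0$, if $w\in H^1(a,b)$ satisfies $$\|w-v\|_{L^1}\le\delta_m\qquad\text{and}\qquad E_\varepsilon[w]\le Nc_p+\varepsilon^{k_m},$$ then $$E_\varepsilon[w]\ge Nc_p-C_m\varepsilon^{k_{m+1}}.$$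
   Context: $[a,b]$ is a fixed bounded interval and $L^1=L^1(a,b)$. The renormalized energy is $$E_\varepsilon[u]=\int_a^b\left[\frac{\varepsilon^{p-1}|u_x|^p}{p}+\frac{F(u)}{\varepsilon}\right]dx$$ (equal to $+\infty$ if the integral diverges), and $$c_p=\left(\frac{p}{p-1}\right)^{\frac{p-1}{p}}\int_{-1}^{1}F(s)^{\frac{p-1}{p}}\,ds.$$ *)

(* Defs.v *)
From HB Require Import structures.
From mathcomp Require Import all_boot all_order all_algebra.
From mathcomp Require Import all_classical all_reals all_analysis.

Set Implicit Arguments.
Unset Strict Implicit.
Unset Printing Implicit Defensive.

Import Order.TTheory GRing.Theory Num.Theory.
Import numFieldNormedType.Exports.

Local Open Scope classical_set_scope.
Local Open Scope ring_scope.

Definition test_function (R : realType) (a b : R) (phi : R -> R) : Prop :=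
  (forall (k : nat) (x : R), derivable (derive1n k phi) x 1) /\
  (exists c d : R, [/\ a < c, d < b &
     forall x : R, x \notin `[c, d] -> phi x = 0]).

Definition weak_derivative (R : realType) (a b : R) (u g : R -> R) : Prop :=
  [/\ locally_integrable `]a, b[ u, locally_integrable `]a, b[ g &
   forall phi : R -> R, test_function a b phi ->
     \int[lebesgue_measure]_(x in `]a, b[) (u x * derive1 phi x) =
     - \int[lebesgue_measure]_(x in `]a, b[) (g x * phi x)].

Definition square_integrable (R : realType) (a b : R) (u : R -> R) : Prop :=
  measurable_fun `]a, b[ u /\
  (\int[lebesgue_measure]_(x in `]a, b[) (`|u x| ^+ 2)%:E < +oo)%E.

Definition H1 (R : realType) (a b : R) (u : R -> R) : Prop :=
  square_integrable a b u /\
  exists2 g : R -> R, weak_derivative a b u g & square_integrable a b g.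

(* A chosen representative: weak derivatives are unique almost everywhere on
   ]a, b[. The default 0 is only used when u has no weak derivative. *)
Definition wderiv (R : realType) (a b : R) (u : R -> R) : R -> R :=
  xget (cst 0) [set g | weak_derivative a b u g].

Definition L1norm (R : realType) (a b : R) (u : R -> R) : \bar R :=
  (\int[lebesgue_measure]_(x in `]a, b[) `|u x|%:E)%E.

(* The integrand is nonnegative when F is and eps, p > 0, so a divergent
   integral takes the value +oo. *)
Definition energy (R : realType) (a b p : R) (F : R -> R) (eps : R)
    (u : R -> R) : \bar R :=
  (\int[lebesgue_measure]_(x in `]a, b[)
     ((eps `^ (p - 1) * `|wderiv a b u x| `^ p) / p + F (u x) / eps)%:E)%E.

Definition transition_cost (R : realType) (p : R) (F : R -> R) : R :=
  (p / (p - 1)) `^ ((p - 1) / p) *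
  \int[lebesgue_measure]_(s in `[(-1 : R), 1]) (F s `^ ((p - 1) / p)).

Definition potential (R : realType) (n u : R) : R :=
  (2 * n)^-1 * `|1 - u ^+ 2| `^ n.

Definition jump_at (R : realType) (v : R -> R) (x : R) : Prop :=
  exists l r : R, [/\ v y @[y --> x^'-] --> l, v y @[y --> x^'+] --> r & l != r].

(* v is {-1, 1}-valued on ]a, b[, constant on each component of ]a, b[ minus
   the h i, and its discontinuities h i are genuine jumps: an isolated value of
   v at a point, invisible in L^1, does not count. *)
Definition pm1_step_function (R : realType) (a b : R) (N : nat)
    (h : 'I_N -> R) (v : R -> R) : Prop :=
  [/\ (forall i : 'I_N, a < h i < b),
      (forall i j : 'I_N, (i < j)%N -> h i < h j),
      (forall x : R, x \in `]a, b[ -> v x = -1 \/ v x = 1),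
      (forall x y : R, a < x -> x <= y -> y < b ->
         (forall i : 'I_N, h i \notin `[x, y]) -> v x = v y) &
      (forall i : 'I_N, jump_at v (h i))].

(* Main.v *)
Require Import Defs.
From HB Require Import structures.
From mathcomp Require Import all_boot all_order all_algebra.
From mathcomp Require Import all_classical all_reals all_analysis.
From mathcomp Require Import measurable_realfun ring lra.

Set Implicit Arguments.
Unset Strict Implicit.
Unset Printing Implicit Defensive.

Import Order.TTheory GRing.Theory Num.Theory.
Import numFieldNormedType.Exports.

Local Open Scope classical_set_scope.
Local Open Scope ring_scope.

(** Why the bound holds.  By Young's inequality the energy density dominates
    |w'| Psi(w), where Psi = (p/(p-1))^((p-1)/p) F^((p-1)/p); hence the energy
    of w on [x, y] is at least |Phi(w y) - Phi(w x)| with Phi' = Psi, and the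
    transition cost is Phi(1) - Phi(-1).  If w is within tau of one well at x
    and within tau of the other well at y, then, because Psi vanishes at the
    wells like the power n(p-1)/p of the distance, the energy on [x, y] falls
    short of the transition cost by at most a multiple of tau^(n(p-1)/p + 1).

    Around a jump point of v, such x and y are found on the two halves of an
    annulus r/2 < |t - h| < r.  If the energy in the annulus is at most
    K eps^kappa, then the mean of F(w) there is at most of order eps^(kappa+1),
    while L^1-closeness to v selects the right well; so some points of the
    annulus satisfy tau = O(eps^((kappa+1)/n)).  The resulting shortfall has the
    exponent (kappa+1) ((p-1)/p + 1/n) = alpha (kappa+1).  This is
    [local_transition], and [balls_of_annuli] applies it at every jump.

    Conversely, once every ball of radius r/2 around a jump is known to carry
    the transition cost up to O(eps^lambda), an upper bound N c_p + eps^lambda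
    on the total energy leaves only O(eps^lambda) for the annuli outside these
    balls: this is [annuli_of_balls].  Alternating the two steps, starting from
    the trivial bound O(1) on the annuli, produces kappa |-> alpha (kappa+1) at
    each turn, which is the recursion of k (the values k_1 = 0 and k_2 = alpha
    obey it too).  The radius is halved at each turn, which is why the
    statements [annuli_bound] and [balls_bound] quantify over all small radii.

    The functions w are only given through weak derivatives, so the energy
    estimate needs w to agree almost everywhere with a primitive of its weak
    derivative.  This is obtained by testing the weak derivative against
    smoothed indicator functions of [x, y], x and y being Lebesgue points of w
    ([weak_derivative_lebesgue_pt]).  The estimate along [x, y] then follows
    from a continuity argument on the right end point
    ([norm_primitive_comp_le]), in place of a chain rule for absolutely
    continuous functions. *)

(** * A smooth step function *)

Section FlatFunctions.
Context {R : realType}.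
Implicit Types (t c d : R) (f : R -> R) (k : nat).

Definition flat k t : R := if 0 < t then t^-1 ^+ k * expR (- t^-1) else 0.

(** The exponential beats every power; by induction on k, spending half of
    the decay rate on each factor s. *)
Lemma expRN_dominates k (a : R) : 0 < a ->
  exists2 C, 0 <= C & forall s : R, 0 <= s -> s ^+ k * expR (- (a * s)) <= C.
Proof.
elim: k a => [|k IH] a a0.
  exists 1 => // s s0; rewrite expr0 mul1r -expR0 ler_expR oppr_le0.
  by rewrite mulr_ge0// ltW.
have a20 : 0 < a / 2 by rewrite divr_gt0.
have [C C0 hC] := IH _ a20.
exists (C * (a / 2)^-1); first by rewrite mulr_ge0// invr_ge0 ltW.
move=> s s0.
have -> : s ^+ k.+1 * expR (- (a * s)) =
    (s ^+ k * expR (- (a / 2 * s))) * (s * expR (- (a / 2 * s))).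
  rewrite mulrACA -exprSr -expRD; congr (_ * expR _); lra.
apply: ler_pM; rewrite ?mulr_ge0 ?exprn_ge0 ?expR_ge0//; first exact: hC.
rewrite expRN ler_pdivrMr ?expR_gt0// -ler_pdivrMl ?invr_gt0// invrK.
apply: le_trans (expR_ge1Dx _); lra.
Qed.

(** At 0 the difference quotient is h times a bounded function of 1/h, by
    [expRN_dominates]; this is where the flatness of exp(-1/t) enters. *)
Lemma is_derive_flat k t :
  is_derive t 1 (flat k) (flat k.+2 t - k%:R * flat k.+1 t).
Proof.
have [t0|t0|->] := ltgtP t 0.
- have -> : flat k.+2 t - k%:R * flat k.+1 t = 0.
    by rewrite /flat ltNge (ltW t0)/= mulr0 subr0.
  have := is_derive_cst (0 : R) t (1 : R); apply: near_eq_is_derive.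
  near=> y; rewrite /flat ltNge; case: leP => //= y0.
  have : y < 0 by near: y; exact: lt_nbhsl.
  by rewrite ltNge (ltW y0).
- pose q (y : R) : R := y ^+ k * expR (- y).
  have tn0 : t != 0 by rewrite gt_eqF.
  suff : is_derive t 1 (q \o GRing.inv) (flat k.+2 t - k%:R * flat k.+1 t).
    apply: near_eq_is_derive; near=> y; rewrite /flat ifT//; near: y.
    exact: lt_nbhsr.
  have dV : is_derive t 1 (fun y : R => y^-1) (- t ^- 2).
    have := @is_deriveV _ (@id R) t 1 1 tn0 (is_derive_id _ _).
    by rewrite /GRing.scale/= mulr1.
  have dX : is_derive t^-1 1 (fun y : R => y ^+ k) (t^-1 ^+ k.-1 *+ k).
    have := is_derive_poly ('X^k : {poly R}) t^-1.
    rewrite derivXn hornerMn hornerXn.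
    by congr (is_derive _ _ _ _); apply/funext => y; rewrite hornerXn.
  have dE : is_derive t^-1 1 (fun y : R => expR (- y)) (- expR (- t^-1)).
    have := is_derive1_comp (is_derive_expR _) (is_deriveNid t^-1 (1 : R)).
    by rewrite mulrN1.
  have dqV := is_derive1_comp (is_deriveM dX dE : is_derive _ _ q _) dV.
  apply: (is_derive_eq dqV).
  rewrite /flat t0 /GRing.scale/= -exprVn -[_ *+ k]mulr_natl.
  case: k {dX dqV q} => [|k] /=; first by rewrite !mulr0n; ring.
  rewrite !exprS; ring.
- have -> : flat k.+2 0 - k%:R * flat k.+1 0 = 0.
    by rewrite /flat ltxx/= mulr0 subr0.
  have [C C0 hC] := expRN_dominates k.+2 (@ltr01 R).
  have lim0 : (fun h => h^-1 *: (flat k (h *: 1 + 0) - flat k 0)) @ 0^' --> 0.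
    apply/cvgrPdist_le => /= e e0; near=> h.
    have hn0 : h != 0 by near: h; exact: nbhs_dnbhs_neq.
    rewrite sub0r normrN addr0 /GRing.scale/= mulr1 /flat ltxx subr0.
    case: ifPn => [h0|_]; last by rewrite mulr0 normr0 ltW.
    rewrite ger0_norm; last first.
      by rewrite !mulr_ge0 ?exprn_ge0 ?expR_ge0 ?invr_ge0 ?ltW.
    have -> : h^-1 * (h^-1 ^+ k * expR (- h^-1)) =
        h * (h^-1 ^+ k.+2 * expR (- (1 * h^-1))).
      rewrite mul1r !exprS; field.
      by rewrite hn0.
    (* C + 1 rather than C, to divide by a positive number. *)
    have Ch : h * (C + 1) <= e.
      rewrite -ler_pdivlMr ?ltr_wpDl//.
      apply: le_trans (ler_norm _) _.
      by near: h; apply: dnbhs0_le; rewrite divr_gt0// ltr_wpDl.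
    apply: le_trans Ch; apply: ler_wpM2l; first exact: ltW.
    have /hC hCh : 0 <= h^-1 by rewrite invr_ge0 ltW.
    by apply: le_trans hCh _; rewrite lerDl.
  apply: DeriveDef; first by apply/cvg_ex; exists 0.
  exact: cvg_lim lim0.
Unshelve. all: by end_near.
Qed.

(** A class of functions stable under differentiation, described
    syntactically so that smoothness of a composite expression follows from
    its shape, without a Leibniz or Faa di Bruno formula. *)
Inductive flat_algebra : (R -> R) -> Prop :=
| fa_cst c : flat_algebra (cst c)
| fa_flat k c d : flat_algebra (fun t => flat k (c * t + d))
| fa_add f g : flat_algebra f -> flat_algebra g ->
    flat_algebra (fun t => f t + g t)
| fa_mul f g : flat_algebra f -> flat_algebra g ->
    flat_algebra (fun t => f t * g t)
| fa_inv f : flat_algebra f -> (forall t, f t != 0) ->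
    flat_algebra (fun t => (f t)^-1).

Lemma is_derive_affine (c d t : R) : is_derive t 1 (fun s : R => c * s + d) c.
Proof.
have h := is_deriveD (is_deriveZ c (is_derive_id t (1 : R)))
  (is_derive_cst d t (1 : R)).
by apply: (is_derive_eq h); rewrite addr0 /GRing.scale/= mulr1.
Qed.

Lemma flat_algebra_derive f : flat_algebra f ->
  exists2 g, flat_algebra g & forall t, is_derive t 1 f (g t).
Proof.
elim=> {f} [c|k c d|f1 f2 _ [g1 ag1 d1] _ [g2 ag2 d2]
           |f1 f2 a1 [g1 ag1 d1] a2 [g2 ag2 d2]|f1 a1 [g1 ag1 d1] f1n0].
- by exists (cst 0); [exact: fa_cst|move=> t; exact: is_derive_cst].
- exists (fun t => (flat k.+2 (c * t + d) +
                    cst (- k%:R) t * flat k.+1 (c * t + d)) * cst c t).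
    apply: fa_mul; last exact: fa_cst.
    by apply: fa_add; [|apply: fa_mul; first exact: fa_cst]; exact: fa_flat.
  move=> t; have h := is_derive1_comp (is_derive_flat k _) (is_derive_affine c d t).
  apply: (is_derive_eq h).
  by rewrite /cst mulNr.
- exists (fun t => g1 t + g2 t); first exact: fa_add.
  by move=> t; exact: (is_deriveD (d1 t) (d2 t)).
- exists (fun t => f1 t * g2 t + f2 t * g1 t).
    by apply: fa_add; exact: fa_mul.
  by move=> t; exact: (is_deriveM (d1 t) (d2 t)).
- exists (fun t => (cst (- 1) t * ((f1 t)^-1 * (f1 t)^-1)) * g1 t).
    by apply: fa_mul => //; apply: fa_mul; [exact: fa_cst|apply: fa_mul; exact: fa_inv].
  move=> t; apply: (is_derive_eq (is_deriveV (f1n0 t) (d1 t))).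
  by rewrite /GRing.scale/= /cst mulN1r expr2 invfM.
Qed.

(** Immediate from stability under differentiation: the k-th derivative of
    a member is a member, hence derivable. *)
Lemma flat_algebra_smooth f k t : flat_algebra f ->
  derivable (derive1n k f) t 1.
Proof.
elim: k f t => [|k IH] f t /flat_algebra_derive[g ag df].
  exact: (@ex_derive _ _ _ _ _ _ _ (df t)).
rewrite /derive1n iterSr -/(derive1n k _).
have -> : derive1 f = g.
  by apply/funext => s; rewrite derive1E; exact: (@derive_val _ _ _ _ _ _ _ (df s)).
exact: IH.
Qed.

Lemma flat_algebra_affine f c d : flat_algebra f ->
  flat_algebra (fun t => f (c * t + d)).
Proof.
elim=> {f} [e|k c' d'|f g _ hf _ hg|f g _ hf _ hg|f _ hf f0].
- exact: fa_cst.
- rewrite (_ : (fun t => _) = fun t => flat k (c' * c * t + (c' * d + d'))).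
    exact: fa_flat.
  by apply/funext => t; congr flat; ring.
- exact: fa_add.
- exact: fa_mul.
- exact: fa_inv.
Qed.

Lemma flat_ge0 k t : 0 <= flat k t.
Proof.
rewrite /flat; case: ifPn => // t0.
by rewrite mulr_ge0 ?expR_ge0// exprn_ge0// invr_ge0 ltW.
Qed.

Lemma flat0_gt0 t : 0 < t -> 0 < flat 0 t.
Proof. by move=> t0; rewrite /flat t0 expr0 mul1r expR_gt0. Qed.

Let denom t : R := flat 0 t + flat 0 (1 - t).

Let denom_gt0 t : 0 < denom t.
Proof.
rewrite /denom; have [t0|t0] := ltP 0 t; first by rewrite ltr_pwDl ?flat0_gt0// flat_ge0.
by rewrite ltr_wpDl ?flat_ge0// flat0_gt0; lra.
Qed.

(** With f(t) = exp(-1/t) for t > 0 and f = 0 elsewhere, take the quotient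
    f(t) / (f(t) + f(1 - t)), whose denominator never vanishes. *)
Lemma smooth_step_exists : exists S : R -> R, [/\ flat_algebra S,
  forall t, 0 <= S t <= 1, forall t, t <= 0 -> S t = 0 &
  forall t, 1 <= t -> S t = 1].
Proof.
exists (fun t => flat 0 t * (denom t)^-1); split.
- have af : flat_algebra (flat 0).
    rewrite (_ : flat 0 = fun t => flat 0 (1 * t + 0)); first exact: fa_flat.
    by apply/funext => t; rewrite mul1r addr0.
  apply: fa_mul => //; apply: fa_inv; last by move=> t; rewrite gt_eqF.
  apply: fa_add => //.
  rewrite (_ : (fun t => _) = fun t => flat 0 (- 1 * t + 1)); first exact: fa_flat.
  by apply/funext => t; rewrite mulN1r addrC.
- move=> t; rewrite divr_ge0 ?flat_ge0 ?(ltW (denom_gt0 t))//=.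
  by rewrite ler_pdivrMr// mul1r lerDl flat_ge0.
- by move=> t t0; rewrite {1}/flat ltNge t0 mul0r.
- move=> t t1; have -> : denom t = flat 0 t.
    by rewrite /denom {2}/flat subr_gt0 ltNge t1/= addr0.
  by rewrite divff// gt_eqF// flat0_gt0// (lt_le_trans ltr01).
Qed.

Lemma flat_algebra_continuous f : flat_algebra f -> continuous f.
Proof.
move=> /flat_algebra_derive[g _ df] t.
apply/differentiable_continuous/derivable1_diffP.
exact: (@ex_derive _ _ _ _ _ _ _ (df t)).
Qed.

(** The step together with its derivative, which is bounded because it is
    continuous and supported in [0, 1]. *)
Lemma smooth_step_derivative : exists S s : R -> R, exists M : R, [/\
  flat_algebra S /\ flat_algebra s,
  (forall t, is_derive t 1 S (s t)),
  (forall t, 0 <= S t <= 1) /\ (forall t, `|s t| <= M),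
  (forall t, t <= 0 -> S t = 0) /\ (forall t, 1 <= t -> S t = 1) &
  (forall t, t \notin `[0, 1] -> s t = 0)].
Proof.
have [S [aS S01 S0 S1]] := smooth_step_exists.
have [s as_ dS] := flat_algebra_derive aS.
have s0 t : t \notin `[0, 1] -> s t = 0.
  rewrite in_itv/= negb_and -!ltNge => t01.
  have [c hc] : exists c, \near t, cst c t = S t.
    case/orP: t01 => ht.
    - exists 0; near=> y; rewrite S0//; near: y; exact: lt_le_nbhsl.
    - exists 1; near=> y; rewrite S1//; near: y; exact: lt_le_nbhsr.
  have dc := near_eq_is_derive hc (is_derive_cst c t (1 : R)).
  by rewrite -(@derive_val _ _ _ _ _ _ _ (dS t)) (@derive_val _ _ _ _ _ _ _ dc).
have cs : {within `[0, 1], continuous (fun t => `|s t|)}.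
  apply: continuous_subspaceT => t; apply: cvg_norm.
  exact: flat_algebra_continuous.
have [m _ hm] := EVT_max (@ler01 R) cs.
exists S, s, `|s m|; split => //; split => // t.
by have [/hm//|/s0 ->] := boolP (t \in `[0, 1]); rewrite normr0.
Unshelve. all: by end_near.
Qed.

End FlatFunctions.

(** * Weak derivatives and Lebesgue points *)

Section WeakDerivative.
Context {R : realType}.
Implicit Types (f g u w : R -> R) (x y c d e : R).
Notation mu := (@lebesgue_measure R).

Lemma integral_support (D E : set R) (f : R -> \bar R) : E `<=` D ->
  (forall t, D t -> ~ E t -> f t = 0%E) ->
  (\int[mu]_(t in D) f t = \int[mu]_(t in E) f t)%E.
Proof.
move=> ED f0; rewrite -(setIidr ED) integral_mkcondr; apply: eq_integral => t.
by rewrite inE patchE => Dt; case: ifPn => // /negP; rewrite inE => /f0 ->.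
Qed.

Lemma Rintegral_support (D E : set R) f : E `<=` D ->
  (forall t, D t -> ~ E t -> f t = 0) ->
  \int[mu]_(t in D) f t = \int[mu]_(t in E) f t.
Proof.
move=> ED f0; rewrite /Rintegral; congr fine.
by apply: integral_support => // t Dt Et; rewrite f0.
Qed.

Lemma Rintegral_le (D : set R) f K : (forall t, D t -> 0 <= f t) ->
  (\int[mu]_(t in D) (f t)%:E <= K%:E)%E -> \int[mu]_(t in D) f t <= K.
Proof.
move=> f0; have : (0 <= \int[mu]_(t in D) (f t)%:E)%E by exact: integral_ge0.
by rewrite /Rintegral; case: (\int[mu]_(t in D) (f t)%:E)%E.
Qed.

(** An epsilon form of the definition of Lebesgue points, with the measure
    of the ball cleared from the denominator. *)
Lemma lebesgue_pt_average f x : lebesgue_pt f x -> forall e, 0 < e ->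
  \forall r \near 0^'+,
    (\int[mu]_(t in ball x r) `|f t - f x|%:E <= (e * r)%:E)%E.
Proof.
move=> /fine_cvgP[fin lim] e e0; near=> r.
have r0 : 0 < r by near: r; exact: nbhs_right_gt.
have davg_fin : davg f x r \is a fin_num by near: r.
have : `|0 - fine (davg f x r)| <= e / 2.
  near: r; move/cvgrPdist_le : lim; apply; lra.
rewrite sub0r normrN => /(le_trans (ler_norm _)) h.
have {}h : (davg f x r <= (e / 2)%:E)%E by rewrite -(fineK davg_fin) lee_fin.
move: h; rewrite /davg /iavg (lebesgue_measure_ball _ (ltW r0)).
have r2 : r *+ 2 != 0 by rewrite mulrn_eq0/= gt_eqF.
rewrite inver (negbTE r2) => h.
have r20 : (0 <= (r *+ 2)%:E)%E by rewrite lee_fin mulrn_wge0// ltW.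
have := lee_wpmul2l r20 h.
rewrite muleA -EFinM divff// mul1e -EFinM => /le_trans; apply.
rewrite lee_fin; lra.
Unshelve. all: by end_near.
Qed.

Lemma subset_ball_itvcc c d x r : c < x - r -> x + r < d -> ball x r `<=` `[c, d].
Proof. by move=> h1 h2; rewrite ball_itv; apply: subset_itv; rewrite bnd_simp ltW. Qed.

Lemma in_ball_double x e t : 0 < e -> 0 <= t - x -> t - x <= e -> ball x (e * 2) t.
Proof.
by move=> *; rewrite ball_itv/= in_itv/=; apply/andP; split; lra.
Qed.

Variables (S s : R -> R) (M : R).
Hypotheses (dS : forall t : R, is_derive t 1 S (s t)) (cs : continuous s)
  (S01 : forall t, 0 <= S t <= 1) (sM : forall t, `|s t| <= M)
  (S0 : forall t, t <= 0 -> S t = 0) (S1 : forall t, 1 <= t -> S t = 1)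
  (s0 : forall t, t \notin `[0, 1] -> s t = 0).

Let cS : continuous S.
Proof.
move=> t; apply/differentiable_continuous/derivable1_diffP.
exact: (@ex_derive _ _ _ _ _ _ _ (dS t)).
Qed.

Let scale x e t : R := (t - x) / e.

Let cscale x e : continuous (scale x e).
Proof.
by move=> t; apply: cvgMl; apply: cvgB; [exact: cvg_id|exact: cvg_cst].
Qed.

Let is_derive_scale x e (t : R) : is_derive t 1 (S \o scale x e) (e^-1 * s (scale x e t)).
Proof.
have ds : is_derive t 1 (scale x e) e^-1.
  have := is_derive_affine e^-1 (- (x / e)) t.
  congr (is_derive _ _ _ _); apply/funext => z; rewrite /scale; ring.
by apply: (is_derive_eq (is_derive1_comp (dS _) ds)); rewrite mulrC.
Qed.

Lemma integral_bump c d x e : c < x -> 0 < e -> x + e < d ->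
  \int[mu]_(t in `[c, d]) (e^-1 * s (scale x e t)) = 1.
Proof.
move=> cx e0 xed.
have cSs : continuous (S \o scale x e).
  by move=> t; apply: continuous_comp; [exact: cscale|exact: cS].
rewrite /Rintegral (@continuous_FTC2 _ _ (S \o scale x e)) //.
- rewrite /= S1 ?S0 ?subr0//; rewrite /scale.
  + by rewrite pmulr_lle0 ?invr_gt0// subr_le0 ltW.
  + by rewrite ler_pdivlMr// mul1r; lra.
- lra.
- apply: continuous_subspaceT => t; apply: cvgMr.
  by apply: continuous_comp; [exact: cscale|exact: cs].
- split.
  + move=> t _; exact: (@ex_derive _ _ _ _ _ _ _ (is_derive_scale x e t)).
  + exact/cvg_at_right_filter/cSs.
  + exact/cvg_at_left_filter/cSs.
- move=> t _; rewrite derive1E.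
  exact: (@derive_val _ _ _ _ _ _ _ (is_derive_scale x e t)).
Qed.

Let measurable_scale x e (D : set R) (f : R -> R) : continuous f ->
  measurable_fun D (f \o scale x e).
Proof.
move=> cf; apply: measurable_funTS; apply: continuous_measurable_fun.
by move=> t; apply: continuous_comp; [exact: cscale|exact: cf].
Qed.

Lemma integrableM_bounded (D : set R) f (h : R -> R) (K : R) : measurable D ->
  mu.-integrable D (EFin \o f) -> measurable_fun D h -> (forall t, D t -> `|h t| <= K) ->
  mu.-integrable D (EFin \o (fun t => f t * h t)).
Proof.
move=> mD fi mh hK.
have := @integrableMl _ _ _ mu _ mD (EFin \o f) h fi mh.
apply; exists K; split; first exact: num_real.
by move=> z Kz t Dt; apply: le_trans (hK _ Dt) (ltW Kz).
Qed.

(** Rescaled bumps have integral 1 and size O(1/e) on an interval of length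
    e, so the error is controlled by the mean of |f - f x| on a ball around x,
    which tends to 0 at a Lebesgue point. *)
Lemma bump_average f c d x : mu.-integrable `[c, d] (EFin \o f) ->
  c < x < d -> lebesgue_pt (f \_ `[c, d]) x ->
  \int[mu]_(t in `[c, d]) (f t * (e^-1 * s (scale x e t))) @[e --> 0^'+] --> f x.
Proof.
move=> fi /andP[cx xd] fx; apply/cvgrPdist_le => /= eta eta0.
have M0 : 0 <= M by apply: le_trans (sM 0).
have K0 : 0 < eta / (2 * (M + 1)) by rewrite divr_gt0// mulr_gt0// ltr_wpDl.
have xcd : x \in `[c, d]%classic by rewrite inE/= in_itv/= !ltW.
(* The ball of radius 2e is open and contains the support [x, x + e]. *)
have [r0 /= r00 avg] := lebesgue_pt_average fx K0.
near=> e.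
have e0 : 0 < e by near: e; exact: nbhs_right_gt.
have xed : x + e < d by rewrite -ltrBrDl; near: e; apply: nbhs_right_lt; lra.
have : e < r0 / 2 by near: e; apply: nbhs_right_lt; lra.
have xec : c < x - e * 2.
  rewrite ltrBrDr -ltrBrDl -ltr_pdivlMr//; near: e; apply: nbhs_right_lt; lra.
have xed2 : x + e * 2 < d.
  rewrite -ltrBrDl -ltr_pdivlMr//; near: e; apply: nbhs_right_lt; lra.
move=> er0; have avgE := avg (e * 2).
have {}avgE : (\int[mu]_(t in ball x (e * 2))
    `|(f \_ `[c, d]) t - (f \_ `[c, d]) x|%:E <= (eta / (2 * (M + 1)) * (e * 2))%:E)%E.
  apply: avgE; last by rewrite mulr_gt0.
  by rewrite /ball_/= sub0r normrN gtr0_norm ?mulr_gt0// -ltr_pdivlMr.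
pose eta_ t := e^-1 * s (scale x e t).
have meta : measurable_fun `[c, d] eta_.
  by apply: measurable_funM => //; exact: measurable_scale.
have etaM t : `|eta_ t| <= e^-1 * M.
  rewrite normrM gtr0_norm ?invr_gt0//; apply: ler_wpM2l => //.
  by rewrite invr_ge0 ltW.
have segc := @segment_compact R c d.
have etac : continuous eta_.
  by move=> t; apply: cvgMr; apply: continuous_comp; [exact: cscale|exact: cs].
have etai : mu.-integrable `[c, d] (EFin \o eta_).
  by apply: continuous_compact_integrable => //; exact: continuous_subspaceT.
have -> : f x = \int[mu]_(t in `[c, d]) (f x * eta_ t).
  by rewrite RintegralZl// integral_bump ?mulr1.
have fxi : mu.-integrable `[c, d] (EFin \o (fun t => f x * eta_ t)).
  apply: continuous_compact_integrable => //; apply: continuous_subspaceT => t.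
  by apply: cvgMr; exact: etac.
have fei : mu.-integrable `[c, d] (EFin \o (fun t => f t * eta_ t)).
  exact: (@integrableM_bounded _ _ _ (e^-1 * M)).
have di : mu.-integrable `[c, d] (EFin \o (fun t => f x * eta_ t - f t * eta_ t)).
  exact: (integrableB _ fxi fei).
rewrite -RintegralB//; apply: le_trans (le_normr_Rintegral _ di) _ => //.
apply: Rintegral_le => // .
have bcd := subset_ball_itvcc xec xed2.
rewrite (@integral_support _ _ _ bcd); last first.
  move=> t _ tb; rewrite /eta_ s0 ?mulr0 ?subrr ?normr0//.
  apply/negP; rewrite /scale in_itv/= => /andP[h1 h2]; apply: tb.
  move: h1 h2; rewrite pmulr_lge0 ?invr_gt0// ler_pdivrMr// mul1r.
  exact: in_ball_double.
have fpE t : ball x (e * 2) t -> (f \_ `[c, d]) t = f t.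
  by move=> /bcd tcd; rewrite patchE mem_set.
have fpx : (f \_ `[c, d]) x = f x by rewrite patchE xcd.
have mf : measurable_fun `[c, d] f by apply/measurable_EFinP; exact: measurable_int fi.
have mfp : measurable_fun (ball x (e * 2)) (fun t => `|(f \_ `[c, d]) t - (f \_ `[c, d]) x|).
  apply: (@eq_measurable_fun _ _ _ _ _ (fun t => `|f t - f x|)).
    by move=> t; rewrite inE => tb; rewrite fpE// fpx.
  apply: measurableT_comp => //; apply: measurable_funB => //.
  exact: measurable_funS mf.
apply: (@le_trans _ _ (\int[mu]_(t in ball x (e * 2))
   (`|(f \_ `[c, d]) t - (f \_ `[c, d]) x|%:E * (e^-1 * M)%:E))%E).
  apply: ge0_le_integral => //.
  - exact: measurable_ball.
  - apply/measurable_EFinP; apply: measurableT_comp => //.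
    apply/measurable_EFinP; apply: measurable_funS bcd _ => //.
    exact: measurable_int di.
  - by apply/measurable_EFinP; apply: measurable_funM.
  - move=> t tb; rewrite -EFinM lee_fin -mulrBl normrM fpE// fpx distrC.
    exact: ler_wpM2l.
rewrite ge0_integralZr//; last 3 first.
- exact: measurable_ball.
- exact/measurable_EFinP.
- by rewrite lee_fin mulr_ge0// invr_ge0 ltW.
apply: le_trans (lee_wpmul2r _ avgE) _; first by rewrite lee_fin mulr_ge0// invr_ge0 ltW.
rewrite -EFinM lee_fin.
have -> : eta / (2 * (M + 1)) * (e * 2) * (e^-1 * M) = eta * (M / (M + 1)).
  by field; rewrite gt_eqF ?gt_eqF// ltr_wpDl.
rewrite ler_piMr ?(ltW eta0)// ler_pdivrMr ?ltr_wpDl// mul1r lerDl ler01.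
Unshelve. all: by end_near.
Qed.

(** The two integrands differ only on [x, x + e], whose contribution
    vanishes with e. *)
Lemma step_integral g c d x : mu.-integrable `[c, d] (EFin \o g) ->
  c < x < d ->
  \int[mu]_(t in `[c, d]) (g t * S (scale x e t)) @[e --> 0^'+] -->
  \int[mu]_(t in `[x, d]) g t.
Proof.
move=> gi /andP[cx xd]; apply/cvgrPdist_le => /= eta eta0.
have xdcd : `[x, d] `<=` `[c, d] by apply: subset_itvr; rewrite bnd_simp ltW.
have gxd : mu.-integrable `[x, d] (EFin \o g) by exact: integrableS gi.
have ngxd : mu.-integrable `[x, d] (EFin \o (fun t => `|g t|)).
  exact: integrable_norm gxd.
have [r /= r0 near_x] := parameterized_integral_near_left xd eta0 ngxd.
near=> e.
have e0 : 0 < e by near: e; exact: nbhs_right_gt.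
have er : e < r by near: e; exact: nbhs_right_lt.
have xed : x + e < d by rewrite -ltrBrDl; near: e; apply: nbhs_right_lt; lra.
pose se t := S (scale x e t).
have se01 t : 0 <= se t <= 1 := S01 _.
have mse (D : set R) : measurable_fun D se by exact: measurable_scale.
have gsi : mu.-integrable `[x, d] (EFin \o (fun t => g t * se t)).
  apply: (@integrableM_bounded _ _ _ 1) => // t _.
  by have /andP[h1 h2] := se01 t; rewrite ger0_norm.
rewrite (@Rintegral_support `[c, d] `[x, d])//; last first.
  move=> t /=; rewrite !in_itv/= => /andP[ct td] h.
  have tx : t <= x by rewrite leNgt; apply/negP => xt; apply: h; rewrite (ltW xt).
  by rewrite S0 ?mulr0// /scale pmulr_lle0 ?invr_gt0// subr_le0.
have di : mu.-integrable `[x, d] (EFin \o (fun t => g t - g t * se t)).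
  exact: (integrableB _ gxd gsi).
rewrite -RintegralB//; apply: le_trans (le_normr_Rintegral _ di) _ => //.
have xexd : `[x, x + e] `<=` `[x, d] by apply: subset_itvl; rewrite bnd_simp ltW.
rewrite (@Rintegral_support `[x, d] `[x, x + e])//; last first.
  move=> t /=; rewrite !in_itv/= => /andP[xt td] h.
  have tx : x + e <= t.
    by rewrite leNgt; apply/negP => xt'; apply: h; rewrite xt (ltW xt').
  rewrite /se S1 ?mulr1 ?subrr ?normr0// /scale ler_pdivlMr// mul1r; lra.
apply: le_trans (ltW (near_x (x + e) _ _)); last by rewrite lerDl ltW.
- rewrite /parameterized_integral; apply: le_trans (ler_norm _).
  apply: le_Rintegral => //.
  + by apply: integrable_norm; exact: integrableS di.
  + exact: (integrableS _ _ _ ngxd).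
  + move=> t _; have /andP[h1 h2] := se01 t.
    rewrite -[X in X - _]mulr1 -mulrBr normrM ler_piMr//.
    by rewrite ger0_norm; lra.
- by rewrite /ball_/= opprD addNKr normrN gtr0_norm.
Unshelve. all: by end_near.
Qed.

Lemma weak_derivative_integrable a b u g c d : weak_derivative a b u g ->
  a < c -> d < b ->
  mu.-integrable `[c, d] (EFin \o u) /\ mu.-integrable `[c, d] (EFin \o g).
Proof.
move=> [[mu_ _ ui] [mg _ gi] _] ac db.
have sub : `[c, d] `<=` `]a, b[ by apply: subset_itv; rewrite bnd_simp.
by split; apply/integrableP; split;
  [apply/measurable_EFinP; exact: measurable_funS mu_|
   exact: ui sub (@segment_compact _ _ _)|
   apply/measurable_EFinP; exact: measurable_funS mg|
   exact: gi sub (@segment_compact _ _ _)].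
Qed.

Hypothesis aS : flat_algebra S.

(** The fundamental theorem of calculus for weak derivatives: the
    difference of two rescaled steps, one rising at x and one rising at y, is a
    test function; as the scale e tends to 0 it tends to the indicator of
    [x, y], while its derivative concentrates at x with mass 1 and at y with
    mass -1. *)
Lemma weak_derivative_lebesgue_pt a b w g c d x y : weak_derivative a b w g ->
  a < c -> d < b -> c < x -> x < y -> y < d ->
  lebesgue_pt (w \_ `[c, d]) x -> lebesgue_pt (w \_ `[c, d]) y ->
  w y - w x = \int[mu]_(t in `[x, y]) g t.
Proof.
move=> wg ac db cx xy yd lx ly.
have [wi gi] := weak_derivative_integrable wg ac db.
have xcd : c < x < d by rewrite cx (lt_trans xy).
have ycd : c < y < d by rewrite yd (lt_trans cx).
have Lw : \int[mu]_(t in `[c, d]) (w t * (e^-1 * s (scale x e t))) -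
    \int[mu]_(t in `[c, d]) (w t * (e^-1 * s (scale y e t)))
    @[e --> 0^'+] --> w x - w y.
  by apply: cvgB; exact: bump_average.
have Lg : - (\int[mu]_(t in `[c, d]) (g t * S (scale x e t)) -
    \int[mu]_(t in `[c, d]) (g t * S (scale y e t))) @[e --> 0^'+] -->
    - (\int[mu]_(t in `[x, d]) g t - \int[mu]_(t in `[y, d]) g t).
  by apply: cvgN; apply: cvgB; exact: step_integral.
have sub : `[c, d] `<=` `]a, b[ by apply: subset_itv; rewrite bnd_simp.
have split_g : \int[mu]_(t in `[x, d]) g t - \int[mu]_(t in `[y, d]) g t =
    \int[mu]_(t in `[x, y]) g t.
  have gxd : mu.-integrable `[x, d] (EFin \o g).
    by apply: integrableS gi => //; apply: subset_itvr; rewrite bnd_simp ltW.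
  rewrite -(Rintegral_itv_obnd_cbnd (r := y)); last first.
    by apply: integrableS gxd => //; apply: subset_itvr; rewrite bnd_simp ltW.
  by rewrite -(Rintegral_itvB gxd) ?bnd_simp ?ltW// subKr.
rewrite -split_g -[RHS]opprK -[LHS]opprB; congr (- _).
suff LwLg : - (\int[mu]_(t in `[c, d]) (g t * S (scale x e t)) -
    \int[mu]_(t in `[c, d]) (g t * S (scale y e t))) @[e --> 0^'+] --> w x - w y.
  exact: (cvg_unique _ LwLg Lg).
apply: cvg_trans Lw; apply: near_eq_cvg; near=> e.
have e0 : 0 < e by near: e; exact: nbhs_right_gt.
have yed : y + e < d by rewrite -ltrBrDl; near: e; apply: nbhs_right_lt; lra.
(* phi rises from 0 to 1 on [x, x + e] and falls back on [y, y + e]. *)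
pose phi t := S (scale x e t) - S (scale y e t).
pose dphi t := e^-1 * s (scale x e t) - e^-1 * s (scale y e t).
have dphiE : derive1 phi = dphi.
  apply/funext => t; rewrite derive1E.
  have := is_deriveB (is_derive_scale x e t) (is_derive_scale y e t).
  by move=> h; exact: (@derive_val _ _ _ _ _ _ _ h).
have phi0 t : t \notin `[x, y + e] -> phi t = 0.
  rewrite in_itv/= negb_and -!ltNge /phi => /orP[tx|yet].
    rewrite !S0 ?subrr// /scale pmulr_lle0 ?invr_gt0// subr_le0 ltW//.
    exact: (lt_trans tx xy).
  have xet : x + e < t by apply: lt_trans yet; rewrite ltrD2r.
  by rewrite !S1 ?subrr// /scale ler_pdivlMr// mul1r lerBrDl ltW.
have dphi0 t : t \notin `[c, d] -> dphi t = 0.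
  move=> tcd; have s_out z : c < z -> z + e < d -> s (scale z e t) = 0.
    move=> cz zed; apply: s0; apply: contra tcd.
    rewrite !in_itv/= /scale pmulr_lge0 ?invr_gt0// ler_pdivrMr// mul1r.
    rewrite subr_ge0 lerBlDl => /andP[h1 h2].
    by rewrite (le_trans (ltW cz) h1) (le_trans h2 (ltW zed)).
  have xed : x + e < d by apply: lt_trans yed; rewrite ltrD2r.
  by rewrite /dphi !s_out ?mulr0 ?subrr// (lt_trans cx).
have test : test_function a b phi.
  split; last first.
    by exists x, (y + e); split; [exact: (lt_trans ac cx)|exact: (lt_trans yed db)|exact: phi0].
  move=> k t; apply: flat_algebra_smooth.
  rewrite (_ : phi = fun t => S (e^-1 * t + (- (x / e))) +
                     cst (- 1) t * S (e^-1 * t + (- (y / e)))).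
    apply: fa_add; first exact: flat_algebra_affine.
    by apply: fa_mul; [exact: fa_cst|exact: flat_algebra_affine].
  apply/funext => z; rewrite /phi /cst mulN1r /scale.
  by congr (S _ - S _); ring.
have := wg; move=> [_ _ /(_ _ test)]; rewrite dphiE.
rewrite (Rintegral_support sub); last first.
  by move=> t _ /negP tcd; rewrite dphi0 ?mulr0.
rewrite (Rintegral_support sub); last first.
  move=> t _ /negP tcd; rewrite phi0 ?mulr0//; apply: contra tcd.
  by apply: subset_itv; rewrite bnd_simp ltW.
have iw z : mu.-integrable `[c, d] (EFin \o (fun t => w t * (e^-1 * s (scale z e t)))).
  apply: (@integrableM_bounded _ _ _ (e^-1 * M)) => //.
    by apply: measurable_funM => //; exact: measurable_scale.
  move=> t _; rewrite normrM gtr0_norm ?invr_gt0//; apply: ler_wpM2l => //.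
  by rewrite invr_ge0 ltW.
have ig z : mu.-integrable `[c, d] (EFin \o (fun t => g t * S (scale z e t))).
  apply: (@integrableM_bounded _ _ _ 1) => //; first exact: measurable_scale.
  by move=> t _; have /andP[h1 h2] := S01 (scale z e t); rewrite ger0_norm.
under eq_Rintegral do rewrite /dphi mulrBr.
rewrite RintegralB// => ->; congr (- _).
by under eq_Rintegral do rewrite /phi mulrBr; rewrite RintegralB.
Unshelve. all: by end_near.
Qed.

End WeakDerivative.

(** * Primitives and a chain inequality *)

Section PrimitivesAndChainRule.
Context {R : realType}.
Implicit Types (f g : R -> R) (x y c d e : R).
Notation mu := (@lebesgue_measure R).

(** Otherwise 1 <= f almost everywhere on D, and integrating contradicts
    the bound on the integral of f. *)
Lemma exists_ae_lt1 (D : set R) (f : R -> \bar R) (P : R -> Prop) :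
  measurable D -> measurable_fun D f -> (forall t, D t -> (0 <= f t)%E) ->
  (\int[mu]_(t in D) f t < mu D)%E -> {ae mu, forall t, P t} ->
  exists t, [/\ D t, P t & (f t < 1)%E].
Proof.
move=> mD mf f0 lt aeP; apply: contrapT => noP.
have : (\int[mu]_(t in D) cst 1 t <= \int[mu]_(t in D) f t)%E.
  apply: ae_ge0_le_integral => //.
  apply: (@filterS _ _ (ae_filter_ringOfSetsType mu)) aeP => t Pt Dt.
  rewrite leNgt; apply/negP => ft.
  by apply: noP; exists t.
by rewrite integral_cst// mul1e leNgt lt.
Qed.

Lemma integrable_scale (D : set R) f k : measurable D ->
  mu.-integrable D (EFin \o f) -> mu.-integrable D (EFin \o (fun t => k * f t)).
Proof.
move=> mD fi; have := integrableZl (mu := mu) mD k fi.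
by apply: eq_integrable => // t _; rewrite /= EFinM.
Qed.

Lemma integral_itvccB f c d x y : mu.-integrable `[c, d] (EFin \o f) ->
  c <= x -> x <= y -> y <= d ->
  \int[mu]_(t in `[c, y]) f t - \int[mu]_(t in `[c, x]) f t =
  \int[mu]_(t in `[x, y]) f t.
Proof.
move=> fi cx xy yd.
have icy : mu.-integrable `[c, y] (EFin \o f).
  by apply: integrableS fi => //; apply: subset_itvl; rewrite bnd_simp.
rewrite (Rintegral_itvB icy) ?bnd_simp//.
apply: Rintegral_itv_obnd_cbnd; apply: integrableS icy => //.
by apply: subset_itvr; rewrite bnd_simp.
Qed.

Lemma continuous_itvcc_integrable f c d : continuous f ->
  mu.-integrable `[c, d] (EFin \o f).
Proof.
move=> cf; apply: continuous_compact_integrable; first exact: segment_compact.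
exact: continuous_subspaceT.
Qed.

(** One of the two intervals is empty or a point, so that this is the
    oriented integral from 0 to u for either sign of u. *)
Definition primitive f u : R :=
  \int[mu]_(t in `[0, u]) f t - \int[mu]_(t in `[u, 0]) f t.

Lemma Rintegral_itv_ge f c d : d <= c -> \int[mu]_(t in `[c, d]) f t = 0.
Proof.
rewrite le_eqVlt => /predU1P[->|dc]; first by rewrite set_itv1 Rintegral_set1.
by rewrite set_itv_ge ?Rintegral_set0// bnd_simp -ltNge.
Qed.

Lemma primitiveB f u v : continuous f -> u <= v ->
  primitive f v - primitive f u = \int[mu]_(t in `[u, v]) f t.
Proof.
move=> cf uv; rewrite /primitive.
have fi c d := @continuous_itvcc_integrable f c d cf.
have [u0|u0] := leP 0 u.
  have v0 : 0 <= v by exact: le_trans uv.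
  rewrite (Rintegral_itv_ge _ u0) (Rintegral_itv_ge _ v0) !subr0.
  exact: (integral_itvccB (fi 0 v)).
rewrite (Rintegral_itv_ge _ (ltW u0)).
have [v0|v0] := leP 0 v.
  rewrite (Rintegral_itv_ge _ v0) subr0 sub0r opprK.
  by rewrite -(integral_itvccB (fi u v) (ltW u0) v0 (lexx _)) subrK.
rewrite (Rintegral_itv_ge _ (ltW v0)) !sub0r opprK addrC.
by rewrite -(integral_itvccB (fi u 0) uv (ltW v0) (lexx _)) subKr.
Qed.

Lemma lebesgue_measure_itvcc c d : c <= d -> mu `[c, d]%classic = (d - c)%:E.
Proof.
move=> cd; rewrite lebesgue_measure_itv/= lte_fin.
by move: cd; rewrite le_eqVlt => /predU1P[->|->//]; rewrite ltxx subrr.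
Qed.

Lemma Rintegral_cst_itv c d K : c <= d ->
  \int[mu]_(t in `[c, d]) K = K * (d - c).
Proof.
move=> cd; rewrite Rintegral_cst//; congr (_ * _).
exact: (congr1 fine (lebesgue_measure_itvcc cd)).
Qed.

Lemma primitive_Lipschitz f u v K : continuous f -> (forall t, 0 <= f t) ->
  (forall t, t \in `[Num.min u v, Num.max u v] -> f t <= K) ->
  `|primitive f v - primitive f u| <= K * `|v - u|.
Proof.
move=> cf f0; wlog uv : u v / u <= v => [wlg|].
  have [uv|vu] := leP u v; first by move=> h; apply: wlg => //; rewrite min_l ?max_r.
  move=> h; rewrite distrC [`|v - u|]distrC; apply: wlg => //; first exact: ltW.
  by rewrite min_l ?max_r// ltW.
rewrite min_l// max_r// => fK.
rewrite primitiveB// ger0_norm ?Rintegral_ge0// ger0_norm ?subr_ge0//.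
rewrite -Rintegral_cst_itv//; apply: le_Rintegral => //.
- exact: continuous_itvcc_integrable.
- by apply: continuous_itvcc_integrable; exact: cst_continuous.
Qed.

(** Induction along an interval: the supremum of the points of [c, d] that
    satisfy P satisfies P, and can be exceeded unless it is d.  The step goes
    from s to u across t so that it serves for both facts. *)
Lemma real_induction (P : R -> Prop) c d : c <= d -> P c ->
  (forall t, c <= t <= d -> exists2 e, 0 < e &
     forall s u, c <= s -> s <= t -> t <= u -> u <= d -> t - e < s -> u < t + e ->
       P s -> P u) ->
  P d.
Proof.
move=> cd Pc step; pose A := [set t | c <= t <= d /\ P t].
have Ac : A c by split; rewrite ?lexx.
have ubA : ubound A d by move=> t [/andP[]].
have supA : has_sup A by split; [exists c|exists d].
pose T := sup A.
have cT : c <= T by exact: ub_le_sup (ex_intro _ d ubA) _ Ac.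
have Td : T <= d by apply: ge_sup => //; exists c.
have [|e e0 eP] := step T; first by rewrite cT.
have [s As eTs] := sup_adherent e0 supA.
have sT : s <= T by exact: ub_le_sup (ex_intro _ d ubA) _ As.
case: As => /andP[cs sd] Ps.
have PT u : T <= u -> u <= d -> u < T + e -> P u.
  by move=> Tu ud ue; exact: (eP s u).
move: Td; rewrite le_eqVlt => /predU1P[Td|Td].
  by apply: PT; rewrite ?Td// ltrDl.
exfalso; pose u := Num.min d (T + e / 2).
have Tu : T < u by rewrite lt_min Td ltrDl; lra.
have ud : u <= d by rewrite ge_min lexx.
have Au : A u.
  split; first by rewrite ud (le_trans cT (ltW Tu)).
  by apply: PT => //; [exact: ltW|rewrite gt_min; apply/orP; right; lra].
by have := ub_le_sup (ex_intro _ d ubA) Au; rewrite leNgt Tu.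
Qed.

Lemma integral_norm_small g c d : mu.-integrable `[c, d] (EFin \o g) ->
  forall r, 0 < r -> exists2 e, 0 < e & forall s u, c <= s -> s <= u -> u <= d ->
    u - s < e -> \int[mu]_(t in `[s, u]) `|g t| < r.
Proof.
move=> gi r r0.
have gT : mu.-integrable setT (EFin \o g \_ `[c, d]).
  by rewrite -restrict_EFin; apply/integrable_restrict => //=; rewrite setTI.
have [e [e0 he]] := integral_normr_continuous gT r0.
exists e => // s u cs su ud use.
have sub : `[s, u] `<=` `[c, d] by apply: subset_itv; rewrite bnd_simp.
have muE : (mu `[s, u]%classic < e%:E)%E by rewrite lebesgue_measure_itvcc.
have := he _ (measurable_itv `[s, u]) muE.
congr (_ < _); apply: eq_Rintegral => t; rewrite inE => /sub tcd.
by rewrite patchE mem_set.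
Qed.

(** For eta > 0 the same bound with Psi(W) + eta in the integrand
    propagates from the left end by [real_induction]: near t the oscillation of
    Psi(W) is below eta, so that the mean value inequality for the primitive
    gives the bound on a short interval.  Then eta tends to 0. *)
Lemma norm_primitive_comp_le (Psi g W : R -> R) c d A : continuous Psi -> (forall t, 0 <= Psi t) ->
  c <= d -> mu.-integrable `[c, d] (EFin \o g) ->
  (forall x, W x = A + \int[mu]_(t in `[c, x]) g t) ->
  `|primitive Psi (W d) - primitive Psi (W c)| <=
    \int[mu]_(t in `[c, d]) (`|g t| * Psi (W t)).
Proof.
move=> cP P0 cd gi WE.
have gn : mu.-integrable `[c, d] (EFin \o (fun t => `|g t|)) by exact: integrable_norm.
have cW : {within `[c, d], continuous W}.
  rewrite (funext WE) => t; apply: cvgD; first exact: cvg_cst.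
  exact: (parameterized_integral_continuous cd gi).
have cPW : {within `[c, d], continuous (Psi \o W)}.
  by move=> t; exact: (@continuous_comp (subspace `[c, d]) R R W Psi t (cW t) (cP _)).
have mPW : measurable_fun `[c, d] (Psi \o W) by exact: subspace_continuous_measurable_fun.
have [m _ hm] := EVT_max cd cPW.
have WB s u : c <= s -> s <= u -> u <= d -> W u - W s = \int[mu]_(t in `[s, u]) g t.
  by move=> cs su ud; rewrite !WE opprD addrACA subrr add0r (integral_itvccB gi).
have sub s u : c <= s -> u <= d -> `[s, u] `<=` `[c, d].
  by move=> cs ud; apply: subset_itv; rewrite bnd_simp.
have Wle s u : c <= s -> s <= u -> u <= d ->
    `|W u - W s| <= \int[mu]_(t in `[s, u]) `|g t|.
  move=> cs su ud; rewrite WB//; apply: le_normr_Rintegral => //.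
  by apply: (integrableS _ _ _ gi) => //; exact: sub.
have iPW eta : mu.-integrable `[c, d] (EFin \o (fun t => `|g t| * (Psi (W t) + eta))).
  apply: (@integrableM_bounded _ _ _ _ (`|Psi (W m)| + `|eta|)) => //.
    exact: measurable_funD.
  move=> t /= tcd; apply: le_trans (ler_normD _ _) _; rewrite lerD2r.
  by rewrite !ger0_norm//; exact: hm.
have key eta : 0 < eta -> `|primitive Psi (W d) - primitive Psi (W c)| <=
    \int[mu]_(t in `[c, d]) (`|g t| * (Psi (W t) + eta)).
  move=> eta0.
  pose P u := `|primitive Psi (W u) - primitive Psi (W c)| <=
    \int[mu]_(t in `[c, u]) (`|g t| * (Psi (W t) + eta)).
  apply: (@real_induction P c d) => //.
    by rewrite /P subrr normr0 set_itv1 Rintegral_set1.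
  move=> t /andP[ct td].
  have eta20 : 0 < eta / 2 by rewrite divr_gt0.
  have /cvgrPdist_lt /(_ _ eta20) [r /= r0 hr] := cP (W t).
  have [e e0 he] := integral_norm_small gi r0.
  exists e => // s u cs st tu ud tes ute.
  have near_t z : s <= z -> z <= u -> `|W t - W z| < r.
    move=> sz zu; have [zt|/ltW tz] := leP z t.
      apply: le_lt_trans (Wle z t _ zt td) _; first exact: le_trans sz.
      apply: he => //; [exact: le_trans sz|lra].
    rewrite distrC; apply: le_lt_trans (Wle t z ct tz _) _; first exact: le_trans ud.
    by apply: he => //; [exact: le_trans ud|lra].
  have su : s <= u by exact: le_trans tu.
  have bnd z : s <= z -> z <= u -> Psi (W t) - eta / 2 <= Psi (W z) <= Psi (W t) + eta / 2.
    move=> sz zu; have /hr := near_t z sz zu; rewrite ltr_norml; lra.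
  have loc : `|primitive Psi (W u) - primitive Psi (W s)| <=
      \int[mu]_(t in `[s, u]) (`|g t| * (Psi (W t) + eta)).
    apply: (@le_trans _ _ ((Psi (W t) + eta / 2) * `|W u - W s|)).
      apply: primitive_Lipschitz => // z.
      rewrite in_itv/= ge_min le_max => /andP[h1 h2].
      have : `|W t - z| < r.
        have := near_t s (lexx _) su; have := near_t u su (lexx _).
        rewrite !ltr_norml; clear -h1 h2 => hu hs.
        by case/orP: h1 => h1; case/orP: h2 => h2; lra.
      by move=> /hr; rewrite ltr_norml; lra.
    apply: (@le_trans _ _ ((Psi (W t) + eta / 2) * \int[mu]_(t in `[s, u]) `|g t|)).
      by apply: ler_wpM2l; [rewrite addr_ge0 ?P0// ltW|exact: Wle].
    have gnsu : mu.-integrable `[s, u] (EFin \o (fun t => `|g t|)).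
      by apply: (integrableS _ _ _ gn) => //; exact: sub.
    rewrite -RintegralZl//; apply: le_Rintegral => //.
    - exact: integrable_scale.
    - by apply: (integrableS _ _ _ (iPW eta)) => //; exact: sub.
    - move=> z /=; rewrite in_itv/= => /andP[sz zu]; rewrite mulrC; apply: ler_wpM2l => //.
      by have := bnd z sz zu; lra.
  rewrite /P => Ps.
  have icu : mu.-integrable `[c, u] (EFin \o (fun t => `|g t| * (Psi (W t) + eta))).
    by apply: (integrableS _ _ _ (iPW eta)) => //; exact: sub.
  have := integral_itvccB icu cs su (lexx _).
  move=> /(canRL (subrK _)) ->; rewrite addrC.
  apply: le_trans (lerD loc Ps).
  apply: le_trans (ler_normD _ _); rewrite le_eqVlt; apply/orP; left.
  by apply/eqP; congr (`|_|); ring.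
have iPW0 : mu.-integrable `[c, d] (EFin \o (fun t => `|g t| * Psi (W t))).
  by have := iPW 0; congr (integrable _ _ _); apply/funext => t /=; rewrite addr0.
apply/ler_addgt0Pr => eps eps0.
pose J := \int[mu]_(t in `[c, d]) `|g t|.
have J0 : 0 <= J by exact: Rintegral_ge0.
have J1 : 0 < J + 1 by rewrite ltr_wpDl.
apply: le_trans (key (eps / (J + 1)) _) _; first exact: divr_gt0.
under eq_Rintegral do rewrite mulrDr.
have gJ : mu.-integrable `[c, d] (EFin \o (fun t => `|g t| * (eps / (J + 1)))).
  have := integrable_scale (eps / (J + 1)) (measurable_itv _) gn.
  by congr (integrable _ _ _); apply/funext => t /=; rewrite mulrC.
rewrite RintegralD//.
rewrite lerD2l RintegralZr// mulrCA ler_piMr ?(ltW eps0)//.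
by rewrite ler_pdivrMr// mul1r lerDl.
Qed.

End PrimitivesAndChainRule.

(** * A lower bound for the energy between two points *)

Section LocalEnergyBound.
Context {R : realType}.
Implicit Types (f g w F : R -> R) (x y c d e p : R).
Notation mu := (@lebesgue_measure R).

(** Almost all points are Lebesgue points of w; fix one of them and compare
    the others with it. *)
Lemma weak_derivative_representative a b w g c d : weak_derivative a b w g ->
  a < c -> c < d -> d < b ->
  exists A, {ae mu, forall t, t \in `]c, d[ ->
    w t = A + \int[mu]_(z in `[c, t]) g z}.
Proof.
move=> wg ac cd db.
have [S [s [M [[aS as_] dS [S01 sM] [S0 S1] s0]]]] := @smooth_step_derivative R.
have cs := flat_algebra_continuous as_.
have [wi gi] := weak_derivative_integrable wg ac db.
have lw := lebesgue_differentiation (integrable_locally_restrict (measurable_itv _) wi).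
have key := weak_derivative_lebesgue_pt dS cs S01 sM S0 S1 s0 aS wg ac db.
have [|x0 [x0cd lx0 _]] := @exists_ae_lt1 _ `]c, d[%classic (cst 0) _
  (measurable_itv _) (measurable_cst _) (fun _ _ => lexx _) _ lw.
  by rewrite integral0 lebesgue_measure_itv/= lte_fin cd -EFinB lte_fin subr_gt0.
exists (w x0 - \int[mu]_(z in `[c, x0]) g z).
apply: (@filterS _ _ (ae_filter_ringOfSetsType mu)) lw => t lt; rewrite in_itv/= => /andP[ct td].
move: x0cd; rewrite /= in_itv/= => /andP[cx0 x0d].
have [tx0|x0t|<-] := ltgtP t x0; last by rewrite subrK.
- have := key t x0 ct tx0 x0d lt lx0.
  rewrite -(integral_itvccB gi (ltW ct) (ltW tx0) (ltW x0d)); lra.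
- have := key x0 t cx0 x0t td lx0 lt.
  rewrite -(integral_itvccB gi (ltW cx0) (ltW x0t) (ltW td)); lra.
Qed.

Definition modica_weight p F u : R :=
  (p / (p - 1)) `^ ((p - 1) / p) * F u `^ ((p - 1) / p).

Definition energy_density p F e g w t : R :=
  (e `^ (p - 1) * `|g t| `^ p) / p + F (w t) / e.

Lemma modica_weight_ge0 p F u : 0 <= modica_weight p F u.
Proof. by rewrite mulr_ge0 ?powR_ge0. Qed.

Lemma energy_density_ge0 p F e g w t : 1 < p -> 0 < e -> (forall u, 0 <= F u) ->
  0 <= energy_density p F e g w t.
Proof.
move=> p1 e0 F0; apply: addr_ge0; last by rewrite divr_ge0// ltW.
by rewrite divr_ge0 ?mulr_ge0 ?powR_ge0//; lra.
Qed.

(** Young's inequality with exponents p and q = p/(p-1), applied to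
    e^((p-1)/p) |w'| and (q F(w)/e)^(1/q); the powers of e cancel in the
    product. *)
Lemma modica_weight_le_density p F e g w t : 1 < p -> 0 < e -> (forall u, 0 <= F u) ->
  `|g t| * modica_weight p F (w t) <= energy_density p F e g w t.
Proof.
move=> p1 e0 F0; rewrite /energy_density /modica_weight.
set q := p / (p - 1); set r := (p - 1) / p.
have p0 : 0 < p by lra.
have p10 : 0 < p - 1 by lra.
have q0 : 0 < q by rewrite divr_gt0.
have r0 : 0 < r by rewrite divr_gt0.
have rq : r * q = 1 by rewrite /r /q; field; rewrite !gt_eqF.
have rp : r * p = p - 1 by rewrite /r; field; rewrite gt_eqF.
have pq : p^-1 + q^-1 = 1 by rewrite /q; field; rewrite !gt_eqF.
have qFe : 0 <= q * F (w t) / e by exact: (divr_ge0 (mulr_ge0 (ltW q0) (F0 _)) (ltW e0)).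
have er0 : 0 <= e `^ r * `|g t| by rewrite mulr_ge0// powR_ge0.
have := conjugate_powR er0 (powR_ge0 (q * F (w t) / e) r) p0 q0 pq.
have -> : (e `^ r * `|g t|) `^ p = e `^ (p - 1) * `|g t| `^ p.
  by rewrite powRM ?powR_ge0// -powRrM rp.
have -> : ((q * F (w t) / e) `^ r) `^ q / q = F (w t) / e.
  by rewrite -powRrM rq powRr1//; field; rewrite !gt_eqF.
apply: le_trans; rewrite le_eqVlt; apply/orP; left; apply/eqP.
have ee : e `^ r * e^-1 `^ r = 1.
  by rewrite -powRM ?invr_ge0 ?(ltW e0)// divff ?gt_eqF// powR1.
have -> : (q * F (w t) / e) `^ r = q `^ r * F (w t) `^ r * e^-1 `^ r.
  have qF : 0 <= q * F (w t) by rewrite mulr_ge0// ltW.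
  by rewrite powRM ?invr_ge0 ?(ltW e0)// powRM ?(ltW q0).
rewrite -[LHS]mul1r -{1}ee; ring.
Qed.

Lemma measurable_energy_density (D : set R) p F e g w : continuous F ->
  measurable_fun D w -> measurable_fun D g ->
  measurable_fun D (fun t => (energy_density p F e g w t)%:E).
Proof.
move=> cF mw mg; apply/measurable_EFinP.
apply: measurable_funD; apply: measurable_funM => //.
  apply: measurable_funM => //.
  by apply: (measurableT_comp (measurable_powR _)); exact: measurableT_comp.
by apply: measurableT_comp => //; exact: continuous_measurable_fun.
Qed.

(** The exceptional null set is the one where w differs from the primitive
    of its weak derivative; it depends on c and d only, so x and y can be
    chosen afterwards. *)
Lemma energy_ge_primitive a b p F e w g c d : weak_derivative a b w g ->
  1 < p -> 0 < e -> (forall u, 0 <= F u) -> continuous F ->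
  continuous (modica_weight p F) -> a < c -> c < d -> d < b ->
  exists G : set R, {ae mu, forall t, t \in `]c, d[ -> G t} /\
    forall x y, c < x -> x <= y -> y < d -> G x -> G y ->
    (`|primitive (modica_weight p F) (w y) - primitive (modica_weight p F) (w x)|%:E
      <= \int[mu]_(t in `[x, y]) (energy_density p F e g w t)%:E)%E.
Proof.
move=> wg p1 e0 F0 cF cP ac cd db.
have [A wA] := weak_derivative_representative wg ac cd db.
exists [set t | w t = A + \int[mu]_(z in `[c, t]) g z]; split => //.
move=> x y cx xy yd /= wx wy.
have [wi gi] := weak_derivative_integrable wg ac db.
have sub : `[x, y] `<=` `[c, d] by apply: subset_itv; rewrite bnd_simp ltW.
have gxy : mu.-integrable `[x, y] (EFin \o g).
  by apply: (integrableS _ _ _ gi) => //.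
pose W t := w x + \int[mu]_(z in `[x, t]) g z.
have WE t : x <= t -> t < d -> W t = A + \int[mu]_(z in `[c, t]) g z.
  move=> xt td; rewrite /W wx -(integral_itvccB gi (ltW cx) xt (ltW td)); ring.
have := norm_primitive_comp_le cP (modica_weight_ge0 p F) xy gxy (fun t => erefl (W t)).
have -> : W y = w y by rewrite WE.
have -> : W x = w x by rewrite WE// ?lexx// (le_lt_trans xy).
rewrite -lee_fin => /le_trans; apply.
have wWae : ae_eq mu `[x, y]%classic (fun t => (`|g t| * modica_weight p F (w t))%:E)
    (fun t => (`|g t| * modica_weight p F (W t))%:E).
  apply: (@filterS _ _ (ae_filter_ringOfSetsType mu)) wA => t wt txy.
  move: (txy); rewrite /= in_itv/= => /andP[xt ty].
  rewrite WE//; last exact: le_lt_trans yd.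
  by rewrite -wt// in_itv/= (lt_le_trans cx)//= (le_lt_trans ty).
have mg : measurable_fun `[x, y] g by apply/measurable_EFinP; exact: measurable_int gxy.
have mw : measurable_fun `[x, y] w.
  by apply: measurable_funS sub _ => //; apply/measurable_EFinP; exact: measurable_int wi.
have mgn : measurable_fun `[x, y] (fun t => `|g t|) by exact: measurableT_comp.
have mPw : measurable_fun `[x, y] (fun t => (`|g t| * modica_weight p F (w t))%:E).
  apply/measurable_EFinP; apply: measurable_funM => //.
  by apply: measurableT_comp => //; exact: continuous_measurable_fun.
have mW : measurable_fun `[x, y] W.
  apply: subspace_continuous_measurable_fun => // t; apply: cvgD; first exact: cvg_cst.
  exact: (parameterized_integral_continuous xy gxy).
have mPW : measurable_fun `[x, y] (fun t => (`|g t| * modica_weight p F (W t))%:E).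
  apply/measurable_EFinP; apply: measurable_funM => //.
  by apply: measurableT_comp => //; exact: continuous_measurable_fun.
have P0 t u : (0 <= (`|g t| * modica_weight p F u)%:E)%E.
  by rewrite lee_fin mulr_ge0// modica_weight_ge0.
apply: (@le_trans _ _ (\int[mu]_(t in `[x, y]) (`|g t| * modica_weight p F (W t))%:E)%E).
  have : (0 <= \int[mu]_(t in `[x, y]) (`|g t| * modica_weight p F (W t))%:E)%E.
    exact: integral_ge0.
  by rewrite /Rintegral; case: (\int[mu]_(t in `[x, y]) _)%E => //= *; exact: leey.
rewrite -(ge0_ae_eq_integral _ _ _ _ _ wWae)//.
apply: ge0_le_integral => //.
- exact: measurable_energy_density.
- by move=> t _; rewrite lee_fin modica_weight_le_density.
Qed.

End LocalEnergyBound.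

(** * The cost of a transition between the wells *)

Section Transition.
Context {R : realType}.
Implicit Types (f g w : R -> R) (x y c d e : R).
Notation mu := (@lebesgue_measure R).

Lemma continuous_norm_powR (r : R) : 0 < r -> continuous (fun x : R => `|x| `^ r).
Proof.
move=> r0 x; have [->|xn0] := eqVneq x 0.
  rewrite /continuous_at normr0 powR0 ?gt_eqF//; apply/cvgrPdist_lt => /= eta eta0.
  near=> y; rewrite sub0r normrN ger0_norm ?powR_ge0//.
  have -> : eta = (eta `^ r^-1) `^ r by rewrite -powRrM mulVf ?gt_eqF// powRr1// ltW.
  apply: gt0_ltr_powR => //; rewrite ?nnegrE ?powR_ge0//.
  rewrite -normrN -[- y]add0r; near: y; apply: cvgr_dist_lt; first exact: cvg_id.
  exact: powR_gt0.
apply: (@continuous_comp _ _ _ (fun x : R => `|x|) (fun z => z `^ r)).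
  exact: norm_continuous.
apply/differentiable_continuous/derivable1_diffP/derivable_powR.
by rewrite in_itv/= andbT normr_gt0.
Unshelve. all: by end_near.
Qed.

Lemma potential_ge0 (n u : R) : 0 < n -> 0 <= potential n u.
Proof. by move=> n0; rewrite mulr_ge0 ?powR_ge0// invr_ge0 mulr_ge0// ltW. Qed.

Lemma continuous_potential (n : R) : 0 < n -> continuous (potential n).
Proof.
move=> n0 u; apply: cvgMr.
apply: (@continuous_comp _ _ _ (fun u : R => 1 - u ^+ 2) (fun x => `|x| `^ n)).
  by apply: cvgB; [exact: cvg_cst|exact: exprn_continuous].
exact: continuous_norm_powR.
Qed.

Variables (p n : R).
Hypotheses (p1 : 1 < p) (n0 : 0 < n).

Let F := @potential R n.
Let Psi := modica_weight p F.
Let q := (p - 1) / p.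

Let p0 : 0 < p. Proof. by apply: lt_trans p1. Qed.
Let q0 : 0 < q. Proof. by rewrite divr_gt0// subr_gt0. Qed.

Let F0 u : 0 <= F u. Proof. exact: potential_ge0. Qed.
Let cF : continuous F. Proof. exact: continuous_potential. Qed.

Lemma continuous_modica_weight_potential : continuous Psi.
Proof.
have -> : Psi = fun u => (p / (p - 1)) `^ q * (`|F u| `^ q).
  by apply/funext => u; rewrite ger0_norm ?potential_ge0.
move=> u; apply: cvgMr.
apply: (@continuous_comp _ _ _ F (fun x => `|x| `^ q)).
  exact: cF.
exact: continuous_norm_powR.
Qed.

Lemma transition_costE :
  transition_cost p F = primitive Psi 1 - primitive Psi (-1).
Proof.
rewrite primitiveB; [|exact: continuous_modica_weight_potential|lra].
rewrite /transition_cost -RintegralZl//; apply: continuous_itvcc_integrable.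
have -> : (fun s : R => F s `^ q) = (fun u => `|F u| `^ q).
  by apply/funext => u; rewrite ger0_norm ?potential_ge0.
move=> u; apply: (@continuous_comp _ _ _ F (fun x => `|x| `^ q)).
  exact: cF.
exact: continuous_norm_powR.
Qed.

Lemma transition_cost_ge0 : 0 <= transition_cost p F.
Proof.
rewrite mulr_ge0 ?powR_ge0// Rintegral_ge0// => t _; exact: powR_ge0.
Qed.

(** On the interval of radius 1 around a well, |1 - s^2| is at most three
    times the distance to the well, which explains the factor 3^n. *)
Definition well_const : R := (p / (p - 1)) `^ q * ((2 * n)^-1 * 3 `^ n) `^ q.

Lemma well_const_ge0 : 0 <= well_const.
Proof. by rewrite mulr_ge0 ?powR_ge0. Qed.

Lemma modica_weight_near_well s sigma tau : sigma ^+ 2 = 1 ->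
  `|s - sigma| <= 1 -> `|s - sigma| <= tau -> Psi s <= well_const * tau `^ (n * q).
Proof.
move=> s21 s1 stau.
have tau0 : 0 <= tau by apply: le_trans stau.
have sig : sigma = 1 \/ sigma = -1.
  by move/eqP : s21; rewrite sqrf_eq1 => /orP[/eqP ->|/eqP ->]; [left|right].
have h3 : `|1 - s ^+ 2| <= 3 * tau.
  have -> : 1 - s ^+ 2 = (s - sigma) * - (s + sigma) by rewrite -s21; ring.
  rewrite normrM normrN mulrC ler_pM//.
  by move: s1; rewrite !ler_norml; case: sig => ->; lra.
rewrite /Psi /modica_weight /well_const -/q -mulrA; apply: ler_wpM2l; first exact: powR_ge0.
have c0 : 0 <= (2 * n)^-1 * 3 `^ n.
  by rewrite mulr_ge0 ?powR_ge0// invr_ge0 mulr_ge0// ltW.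
rewrite (powRrM tau) -(powRM q c0 (powR_ge0 tau n)).
apply: ge0_ler_powR; rewrite ?nnegrE ?F0 ?(ltW q0)//.
  by rewrite mulr_ge0// powR_ge0.
rewrite /F /potential -mulrA; apply: ler_wpM2l; first by rewrite invr_ge0 mulr_ge0// ltW.
rewrite -powRM//; apply: ge0_ler_powR; rewrite ?nnegrE ?mulr_ge0//; exact: ltW.
Qed.

Lemma primitive_near_well s sigma tau : sigma ^+ 2 = 1 ->
  `|s - sigma| <= 1 -> `|s - sigma| <= tau ->
  `|primitive Psi s - primitive Psi sigma| <= well_const * tau `^ (n * q) * tau.
Proof.
move=> s21 s1 stau.
apply: (@le_trans _ _ (well_const * tau `^ (n * q) * `|s - sigma|)); last first.
  by apply: ler_wpM2l => //; rewrite mulr_ge0 ?powR_ge0 ?well_const_ge0.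
apply: primitive_Lipschitz => [|t|t].
- exact: continuous_modica_weight_potential.
- exact: modica_weight_ge0.
- rewrite in_itv/= ge_min le_max => /andP[h1 h2].
  have ts : `|t - sigma| <= `|s - sigma|.
    by case: (ger0P (s - sigma)) => hs; case: (ger0P (t - sigma)) => ht;
      case/orP: h1 => h1; case/orP: h2 => h2; lra.
  apply: (modica_weight_near_well (sigma := sigma)) => //.
    exact: le_trans s1.
  exact: le_trans stau.
Qed.

(** Start from the exact cost between the two wells, and correct by the
    cost between each s_i and its well. *)
Lemma primitive_transition s1 s2 sigma tau : sigma ^+ 2 = 1 ->
  `|s1 - sigma| <= 1 -> `|s1 - sigma| <= tau ->
  `|s2 + sigma| <= 1 -> `|s2 + sigma| <= tau ->
  transition_cost p F - 2 * well_const * (tau `^ (n * q) * tau) <=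
    `|primitive Psi s2 - primitive Psi s1|.
Proof.
move=> s21 h1 h1t h2 h2t.
have := primitive_near_well s21 h1 h1t.
have := @primitive_near_well s2 (- sigma) tau.
rewrite sqrrN opprK => /(_ s21 h2 h2t).
have cpE : transition_cost p F = `|primitive Psi (- sigma) - primitive Psi sigma|.
  have := transition_cost_ge0; rewrite transition_costE => cp0.
  move/eqP : s21; rewrite sqrf_eq1 => /orP[/eqP ->|/eqP ->].
    by rewrite distrC ger0_norm.
  by rewrite opprK ger0_norm.
have -> : 2 * well_const * (tau `^ (n * q) * tau) =
    2 * (well_const * tau `^ (n * q) * tau) by ring.
rewrite cpE; move: (well_const * _ * _) => K.
move: (primitive Psi s1) (primitive Psi s2) (primitive Psi sigma)
  (primitive Psi (- sigma)) => P1 P2 Q1 Q2 k2 k1.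
have -> : Q2 - Q1 = (P2 - P1) + (P1 - Q1) - (P2 - Q2) by ring.
have := ler_normB ((P2 - P1) + (P1 - Q1)) (P2 - Q2).
have := ler_normD (P2 - P1) (P1 - Q1).
move: `|P2 - P1| `|P1 - Q1| `|P2 - Q2| k1 k2 => A1 A2 A3 k1 k2; lra.
Qed.

Let density := energy_density p F.

(** The mean over ]x1, x2[ of |w - sigma| plus a multiple B of the energy
    density is at most 1/2, so the sum is below 1 somewhere.  There w is closer
    to sigma than to the other well, and F(w) <= e / B bounds the distance to
    sigma, since |w - sigma| <= |1 - w^2|. *)
Lemma exists_point_near_well e g w x1 x2 sigma E0 (P : R -> Prop) :
  0 < e -> x1 < x2 -> sigma ^+ 2 = 1 -> 0 < E0 ->
  measurable_fun `]x1, x2[ w -> measurable_fun `]x1, x2[ g ->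
  (\int[mu]_(t in `]x1, x2[) `|w t - sigma|%:E <= ((x2 - x1) / 4)%:E)%E ->
  (\int[mu]_(t in `]x1, x2[) (density e g w t)%:E <= E0%:E)%E ->
  {ae mu, forall t, P t} ->
  exists t, [/\ x1 < t < x2, P t, `|w t - sigma| <= 1 &
    `|w t - sigma| <= (8 * n * E0 * e / (x2 - x1)) `^ n^-1].
Proof.
move=> e0 x12 s21 E00 mw mg wL1 wE aeP.
have l0 : 0 < x2 - x1 by rewrite subr_gt0.
(* This B makes the mean of B times the energy density at most 1/4. *)
pose B := (x2 - x1) / (4 * E0).
have B0 : 0 < B by rewrite divr_gt0// mulr_gt0.
have d0 t : 0 <= density e g w t by apply: energy_density_ge0 => // u; exact: F0.
have mdens := measurable_energy_density p e cF mw mg.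
have mws : measurable_fun `]x1, x2[ (fun t => `|w t - sigma|%:E).
  by apply/measurable_EFinP; apply: measurableT_comp => //; exact: measurable_funB.
have mBd : measurable_fun `]x1, x2[ (fun t => B%:E * (density e g w t)%:E)%E.
  exact: measurable_funeM.
have f0 t : (0 <= `|w t - sigma|%:E + B%:E * (density e g w t)%:E)%E.
  by rewrite adde_ge0// ?mule_ge0// lee_fin// ltW.
have mf := emeasurable_funD mws mBd.
have int_lt : (\int[mu]_(t in `]x1, x2[)
    (`|w t - sigma|%:E + B%:E * (density e g w t)%:E) < mu `]x1, x2[%classic)%E.
  rewrite ge0_integralD//; last first.
    by move=> t _; rewrite mule_ge0// lee_fin// ltW.
  rewrite ge0_integralZl//; [|by move=> t _; rewrite lee_fin|by rewrite lee_fin ltW].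
  have -> : mu `]x1, x2[%classic = (x2 - x1)%:E by rewrite lebesgue_measure_itv/= lte_fin x12.
  apply: (@le_lt_trans _ _ (((x2 - x1) / 4)%:E + B%:E * E0%:E)%E).
    by apply: leeD => //; apply: lee_wpmul2l => //; rewrite lee_fin ltW.
  rewrite -EFinM -EFinD lte_fin.
  have -> : B * E0 = (x2 - x1) / 4 by rewrite /B; field; rewrite gt_eqF.
  lra.
have [t [tx Pt ft]] := exists_ae_lt1 (measurable_itv _) mf (fun t _ => f0 t) int_lt aeP.
exists t; move: tx ft; rewrite /= in_itv/= => tx.
rewrite -EFinM -EFinD lte_fin => ft.
have Bd0 : 0 <= B * density e g w t by rewrite mulr_ge0// ltW.
have w1 : `|w t - sigma| <= 1 by lra.
have Bd1 : B * density e g w t <= 1 by have := normr_ge0 (w t - sigma); lra.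
have Fd : F (w t) / e <= density e g w t.
  by rewrite lerDr divr_ge0 ?mulr_ge0 ?powR_ge0// ltW.
have FT : `|1 - w t ^+ 2| `^ n <= 8 * n * E0 * e / (x2 - x1).
  have : F (w t) <= e / B.
    rewrite ler_pdivlMr//.
    have -> : F (w t) * B = B * (F (w t) / e) * e by field; rewrite gt_eqF.
    rewrite -[leRHS]mul1r; apply: ler_wpM2r; first exact: ltW.
    by apply: le_trans Bd1; apply: ler_wpM2l => //; exact: ltW.
  rewrite /F /potential ler_pdivrMl ?mulr_gt0// => /le_trans; apply.
  rewrite le_eqVlt; apply/orP; left; apply/eqP; rewrite /B; field.
  by rewrite !gt_eqF.
split => //.
have -> : `|w t - sigma| = (`|w t - sigma| `^ n) `^ n^-1.
  by rewrite -powRrM divff ?gt_eqF// powRr1.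
apply: ge0_ler_powR; rewrite ?nnegrE ?powR_ge0 ?invr_ge0 ?(ltW n0)//.
  by apply: le_trans FT; exact: powR_ge0.
apply: le_trans FT; apply: ge0_ler_powR; rewrite ?nnegrE ?(ltW n0)//.
have -> : 1 - w t ^+ 2 = (w t - sigma) * - (w t + sigma) by rewrite -s21; ring.
rewrite normrM normrN ler_peMr//.
move/eqP : s21 w1; rewrite sqrf_eq1 ler_norml => /orP[/eqP ->|/eqP ->] w1.
  by rewrite ger0_norm; lra.
by rewrite ler0_norm; lra.
Qed.

Let alpha := q + n^-1.

(** One point near each well, taken on either side of h, and the energy
    bound between them.  Each half of the annulus has length r/2, so both
    points are within tau = T^(1/n) of their wells, where T is the base of the
    power in the statement; then tau^(n(p-1)/p + 1) = T^alpha. *)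
Lemma local_transition a b e g w h r sigma E0 : weak_derivative a b w g ->
  0 < e -> 0 < r -> a < h - r -> h + r < b -> sigma ^+ 2 = 1 -> 0 < E0 ->
  (\int[mu]_(t in `](h - r)%R, (h - r / 2)%R[) `|w t - sigma|%:E <= (r / 8)%:E)%E ->
  (\int[mu]_(t in `](h + r / 2)%R, (h + r)%R[) `|w t + sigma|%:E <= (r / 8)%:E)%E ->
  (\int[mu]_(t in `](h - r)%R, (h - r / 2)%R[) (density e g w t)%:E <= E0%:E)%E ->
  (\int[mu]_(t in `](h + r / 2)%R, (h + r)%R[) (density e g w t)%:E <= E0%:E)%E ->
  ((transition_cost p F - 2 * well_const * (16 * n / r * (E0 * e)) `^ alpha)%:E <=
   \int[mu]_(t in `](h - r)%R, (h + r)%R[) (density e g w t)%:E)%E.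
Proof.
move=> wg e0 r0 ar rb s21 E00.
have hr : h - r < h + r by lra.
have hr2 : h - r / 2 < h + r / 2 by lra.
have hlr : h - r / 2 < h + r by lra.
have hrl : h - r < h + r / 2 by lra.
have T_half : r / 2 = h - r / 2 - (h - r) /\ r / 2 = h + r - (h + r / 2).
  by split; lra.
move=> L1l L1r El Er.
have [G [aeG GE]] := @energy_ge_primitive R a b p F e w g (h - r) (h + r) wg p1 e0
  F0 cF continuous_modica_weight_potential ar hr rb.
have [[mw _ _] [mg _ _] _] := wg.
have sub x1 x2 : h - r <= x1 -> x2 <= h + r -> `]x1, x2[ `<=` `]a, b[.
  by move=> h1 h2; apply: subset_itv; rewrite bnd_simp; lra.
have subm x1 x2 f : h - r <= x1 -> x2 <= h + r -> measurable_fun `]a, b[ f ->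
    measurable_fun `]x1, x2[ f.
  by move=> h1 h2; apply: measurable_funS => //; exact: sub.
have [||||x [xlr Gx x1 xT]] := @exists_point_near_well e g w (h - r) (h - r / 2) sigma E0 _
  e0 _ s21 E00 _ _ _ El aeG.
- lra.
- by apply: subm => //; lra.
- by apply: subm => //; lra.
- by apply: le_trans L1l _; rewrite lee_fin; lra.
have [|||||y [ylr Gy y1 yT]] := @exists_point_near_well e g w (h + r / 2) (h + r) (- sigma) E0 _
  e0 _ _ E00 _ _ _ Er aeG.
- lra.
- by rewrite sqrrN.
- by apply: subm => //; lra.
- by apply: subm => //; lra.
- under eq_integral do rewrite opprK.
  by apply: le_trans L1r _; rewrite lee_fin; lra.
move: xlr ylr => /andP[hx xh] /andP[hy yh].
rewrite opprK in y1 yT.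
have Tl : 8 * n * E0 * e / (h - r / 2 - (h - r)) = 16 * n / r * (E0 * e).
  rewrite -T_half.1.
  by field; rewrite gt_eqF.
have Tr : 8 * n * E0 * e / (h + r - (h + r / 2)) = 16 * n / r * (E0 * e).
  rewrite -T_half.2.
  by field; rewrite gt_eqF.
rewrite Tl in xT; rewrite Tr in yT.
set T := 16 * n / r * (E0 * e) in xT yT *.
have T0 : 0 <= T by rewrite !mulr_ge0 ?invr_ge0// ltW.
have TE : (T `^ n^-1) `^ (n * q) * T `^ n^-1 = T `^ alpha.
  rewrite -powRrM mulKf ?gt_eqF// /alpha powRD//; apply/implyP => /eqP qn.
  by have := addr_gt0 q0 (_ : 0 < n^-1); rewrite qn ltxx invr_gt0 => /(_ n0).
have xy : x <= y by rewrite ltW// (lt_trans xh)// (lt_trans hr2).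
have tr := primitive_transition s21 x1 xT y1 yT; rewrite TE in tr.
apply: le_trans (_ : (_ <= (_)%:E)%E) _; first by rewrite lee_fin; exact: tr.
have gx : G x by apply: Gx; rewrite in_itv/= hx (lt_trans xh).
have gy : G y by apply: Gy; rewrite in_itv/= yh (lt_trans hrl).
apply: le_trans (GE x y hx xy yh gx gy) _.
apply: ge0_subset_integral => //.
- by apply: measurable_energy_density; [exact: cF|exact: subm|exact: subm].
- by move=> t _; rewrite lee_fin; apply: energy_density_ge0 => // u; exact: F0.
- by apply: subset_itv; rewrite bnd_simp.
Qed.

End Transition.

(** * Disjoint intervals around the jumps *)

Section DisjointIntervals.
Context {R : realType}.
Notation mu := (@lebesgue_measure R).

(** Monotonicity in the domain for a possibly non-measurable integrand, as
    the integral of a nonnegative function is a supremum over the simple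
    functions below it.  It is applied to |w - v|, for which measurability of v
    would otherwise have to be derived. *)
Lemma ge0_integral_subset (A B : set R) (f : R -> \bar R) :
  (forall t, B t -> (0 <= f t)%E) -> A `<=` B ->
  (\int[mu]_(t in A) f t <= \int[mu]_(t in B) f t)%E.
Proof.
move=> f0 AB; rewrite !ge0_integralE//; last by move=> t /AB; exact: f0.
apply: ereal_sup_le => _ [h hf <-]; exists h => // t; apply: le_trans (hf t) _.
rewrite !patchE; case: ifPn => [/set_mem/AB Bt|_]; first by rewrite mem_set.
by case: ifPn => // /set_mem; exact: f0.
Qed.

Lemma ge0_integral_disjoint_sum (N : nat) (D A : set R) (B : 'I_N -> set R)
  (f : R -> \bar R) : measurable D -> measurable A -> (forall j, measurable (B j)) ->
  measurable_fun D f -> (forall t, D t -> (0 <= f t)%E) ->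
  A `<=` D -> (forall j, B j `<=` D) ->
  (forall j, A `&` B j = set0) -> (forall i j, i != j -> B i `&` B j = set0) ->
  (\int[mu]_(t in A) f t + \sum_(j < N) \int[mu]_(t in B j) f t
    <= \int[mu]_(t in D) f t)%E.
Proof.
move=> mD mA mB mf f0 AD BD AB BB.
pose U := \big[setU/set0]_(j <- index_enum 'I_N) B j.
have UD : U `<=` D by rewrite /U; elim/big_ind: _ => // X Y XD YD t [/XD|/YD].
have mU : measurable U by apply: bigsetU_measurable.
have AU : A `&` U = set0.
  rewrite /U; elim/big_ind: _ => [|X Y hX hY|j _]; rewrite ?setI0//.
  by rewrite setIUr hX hY setU0.
rewrite -(@ge0_integral_bigsetU _ _ _ mu _ B f)//; last first.
- by move=> t Ut; apply: f0; exact: UD.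
- exact: measurable_funS UD mf.
- by apply/trivIsetP => i j _ _; exact: BB.
- exact: index_enum_uniq.
rewrite -ge0_integral_setU//.
- by apply: ge0_integral_subset => // t [/AD|/UD].
- by apply: measurable_funS mf => // t [/AD|/UD].
- by move=> t [/AD|/UD]; exact: f0.
- by apply/disj_set2P.
Qed.

(** A single radius serves for all jumps because there are finitely many.
    On either side of h i the function is constant, so these constants are the
    one-sided limits; they differ and both are 1 or -1, hence are opposite. *)
Lemma pm1_step_function_isolated_jumps (a b : R) (N : nat) (h : 'I_N -> R) (v : R -> R) :
  pm1_step_function a b h v ->
  exists r0 : R, exists sg : 'I_N -> R, [/\ 0 < r0,
    (forall i, a < h i - r0 /\ h i + r0 < b),
    (forall i j, i != j -> 2 * r0 <= `|h i - h j|),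
    (forall i, sg i ^+ 2 = 1) &
    (forall i t, (h i - r0 < t < h i -> v t = sg i) /\
                 (h i < t < h i + r0 -> v t = - sg i))].
Proof.
move=> [hab hlt vpm vcst vjump].
have sep i j : i != j -> h i != h j.
  move=> ij; apply: contra ij => /eqP hij.
  have nlt (i' j' : 'I_N) : h i' = h j' -> (j' <= i')%N.
    by move=> e; rewrite leqNgt; apply/negP => /hlt; rewrite e ltxx.
  by apply/eqP/val_inj/eqP; rewrite eqn_leq !nlt.
have ends i : \forall r \near (0 : R)^'+, a < h i - r /\ h i + r < b.
  have /andP[ahi hib] := hab i; near=> r.
  have r1 : r < h i - a by near: r; apply: nbhs_right_lt; rewrite subr_gt0.
  have r2 : r < b - h i by near: r; apply: nbhs_right_lt; rewrite subr_gt0.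
  by split; lra.
have gaps i j : \forall r \near (0 : R)^'+, i != j -> 2 * r <= `|h i - h j|.
  have [->|ij] := eqVneq i j; first by near=> r.
  near=> r => _; rewrite -ler_pdivlMl//; near: r; apply: nbhs_right_le.
  by rewrite mulr_gt0// normr_gt0 subr_eq0; exact: sep.
have [r [r0 [rends rgaps]]] := filter_ex (filterI (nbhs_right_gt (0 : R))
  (filterI (filter_forall _ ends) (filter_forall _ (fun i => filter_forall _ (gaps i))))).
have lconst i x y : h i - r < x -> x <= y -> y < h i -> v x = v y.
  move=> hx xy yh; have [ra rb] := rends i; apply: vcst => //; [lra|lra|].
  move=> j; apply/negP; rewrite in_itv/= => /andP[xj jy].
  have ij : i != j by apply/eqP => ij; move: jy; rewrite -ij leNgt yh.
  by have := rgaps _ _ ij; rewrite ler_normr; case/orP; lra.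
have rconst i x y : h i < x -> x <= y -> y < h i + r -> v x = v y.
  move=> hx xy yh; have [ra rb] := rends i; apply: vcst => //; [lra|lra|].
  move=> j; apply/negP; rewrite in_itv/= => /andP[xj jy].
  have ij : i != j by apply/eqP => ij; move: xj; rewrite -ij leNgt hx.
  by have := rgaps _ _ ij; rewrite ler_normr; case/orP; lra.
have vl i t : h i - r < t < h i -> v t = v (h i - r / 2).
  move=> /andP[t1 t2]; have [tm|/ltW tm] := leP t (h i - r / 2).
    by apply: lconst t1 tm _; lra.
  by apply/esym; apply: (lconst i) => //; lra.
have vr i t : h i < t < h i + r -> v t = v (h i + r / 2).
  move=> /andP[t1 t2]; have [tm|/ltW tm] := leP t (h i + r / 2).
    by apply: rconst t1 tm _; lra.
  by apply/esym; apply: (rconst i) => //; lra.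
have vpml i : v (h i - r / 2) = -1 \/ v (h i - r / 2) = 1.
  have [ra rb] := rends i; apply: vpm; rewrite in_itv/=; apply/andP; split; lra.
have vpmr i : v (h i + r / 2) = -1 \/ v (h i + r / 2) = 1.
  have [ra rb] := rends i; apply: vpm; rewrite in_itv/=; apply/andP; split; lra.
have flip i : v (h i + r / 2) = - v (h i - r / 2).
  have [l [l' [vll vlr ll']]] := vjump i.
  have [ra rb] := rends i.
  have lE : l = v (h i - r / 2).
    apply: (cvg_unique _ vll) => //; apply: cvg_near_cst; near=> t.
    by apply: vl; apply/andP; split => //; near: t; apply: nbhs_left_gt; lra.
  have l'E : l' = v (h i + r / 2).
    apply: (cvg_unique _ vlr) => //; apply: cvg_near_cst; near=> t.
    by apply: vr; apply/andP; split => //; near: t; apply: nbhs_right_lt; lra.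
  move: ll'; rewrite lE l'E.
  by have [->|->] := vpmr i; have [->|->] := vpml i; rewrite ?eqxx ?opprK.
exists r, (fun i => v (h i - r / 2)); split => //.
- by move=> i; have [->|->] := vpml i; rewrite ?sqrrN expr1n.
- by move=> i t; split=> [/vl//|/vr ->].
Unshelve. all: by end_near.
Qed.

End DisjointIntervals.

(** * The bootstrap *)

Section Bootstrap.
Context {R : realType}.
Notation mu := (@lebesgue_measure R).
Variables (a b p n : R) (N : nat) (h : 'I_N -> R) (v : R -> R).
Hypotheses (p1 : 1 < p) (n0 : 0 < n).
Variables (r0 : R) (sg : 'I_N -> R).
Hypotheses (r00 : 0 < r0)
  (ends : forall i, a < h i - r0 /\ h i + r0 < b)
  (gaps : forall i j, i != j -> 2 * r0 <= `|h i - h j|)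
  (sg1 : forall i, sg i ^+ 2 = 1)
  (vsg : forall i t, (h i - r0 < t < h i -> v t = sg i) /\
                 (h i < t < h i + r0 -> v t = - sg i)).

Let F := @potential R n.
Let cp := transition_cost p F.
Let alpha := (p - 1) / p + n^-1.
Let dens eps w := energy_density p F eps (wderiv a b w) w.

Lemma wderivP w : H1 a b w -> weak_derivative a b w (wderiv a b w).
Proof.
move=> [_ [g wg _]].
by have := @xgetPex _ (cst 0) [set g | weak_derivative a b w g] (ex_intro _ g wg).
Qed.

Let dens_ge0 eps w t : 0 < eps -> 0 <= dens eps w t.
Proof. by move=> e0; apply: energy_density_ge0 => // u; exact: (potential_ge0 u n0). Qed.

Let measurable_dens eps w : H1 a b w ->
  measurable_fun `]a, b[ (fun t => (dens eps w t)%:E).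
Proof.
move=> /wderivP[[mw _ _] [mg _ _] _].
by apply: measurable_energy_density => //; exact: (continuous_potential n0).
Qed.

Definition nearly_optimal (delta kappa eps : R) (w : R -> R) : Prop :=
  [/\ H1 a b w, (L1norm a b (fun t => w t - v t)%R <= delta%:E)%E &
    (energy a b p F eps w <= (N%:R * cp + eps `^ kappa)%R%:E)%E].

Definition annuli_bound (kappa : R) : Prop := forall r, 0 < r <= r0 ->
  exists delta K, [/\ 0 < delta, 0 < K & forall eps w, 0 < eps < 1 ->
    nearly_optimal delta kappa eps w -> forall i,
    (\int[mu]_(t in `](h i - r)%R, (h i - r / 2)%R[) (dens eps w t)%:E
       <= (K * eps `^ kappa)%:E)%E /\
    (\int[mu]_(t in `](h i + r / 2)%R, (h i + r)%R[) (dens eps w t)%:E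
       <= (K * eps `^ kappa)%:E)%E].

Definition balls_bound (kappa lambda : R) : Prop := forall r, 0 < r <= r0 ->
  exists delta C, [/\ 0 < delta, 0 < C & forall eps w, 0 < eps < 1 ->
    nearly_optimal delta kappa eps w -> forall i,
    ((cp - C * eps `^ lambda)%:E <=
     \int[mu]_(t in `](h i - r)%R, (h i + r)%R[) (dens eps w t)%:E)%E].

Lemma subset_ball i (r : R) : 0 < r <= r0 -> `](h i - r), (h i + r)[ `<=` `]a, b[.
Proof.
move=> /andP[r_0 rr0]; have [ha hb] := ends i.
by apply: subset_itv; rewrite bnd_simp; lra.
Qed.

Lemma balls_disjoint i j r : r <= r0 -> i != j ->
  `](h i - r), (h i + r)[ `&` `](h j - r), (h j + r)[ = set0.
Proof.
move=> rr0 ij; rewrite -subset0 => t [/=]; rewrite !in_itv/= => /andP[t1 t2] /andP[t3 t4].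
by have := gaps ij; rewrite ler_normr; case/orP; lra.
Qed.

(** The energy in an annulus is at most the total energy. *)
Lemma annuli_bound0 : annuli_bound 0.
Proof.
move=> r rr0; have cp0 : 0 <= cp by exact: transition_cost_ge0.
exists 1, (N%:R * cp + 1); split; rewrite ?ltr01//.
  by rewrite ltr_wpDl// mulr_ge0.
move=> eps w /andP[e0 e1] [_ _]; rewrite powRr0 mulr1 => Ew i.
move/andP: (rr0) => [r_0 _].
have sub := @subset_ball i r rr0.
split; apply: le_trans Ew; apply: ge0_integral_subset => [t _|t /=].
- by rewrite lee_fin dens_ge0.
- by move=> tJ; apply: sub; move: tJ; apply: subset_itv; rewrite bnd_simp; lra.
- by rewrite lee_fin dens_ge0.
- by move=> tJ; apply: sub; move: tJ; apply: subset_itv; rewrite bnd_simp; lra.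
Qed.

(** The exponent comes from [local_transition] with E0 = K eps^kappa: its
    error term is a multiple of (E0 eps)^alpha. *)
Lemma balls_of_annuli kappa : annuli_bound kappa ->
  balls_bound kappa (alpha * (kappa + 1)).
Proof.
move=> ann r rr0; have [delta [K [d0 K0 H]]] := ann r rr0.
move/andP: (rr0) => [r_0 r_r0].
have wc0 : 0 <= well_const p n by exact: well_const_ge0.
exists (Num.min delta (r / 8)), (2 * well_const p n * (16 * n / r * K) `^ alpha + 1).
split.
- by rewrite lt_min d0/=; lra.
- by rewrite ltr_wpDl// !mulr_ge0// powR_ge0.
move=> eps w eps01 [wH1 L1 Ew] i; have /andP[e0 e1] := eps01.
have L1r : (L1norm a b (fun t => w t - v t)%R <= (r / 8)%:E)%E.
  by apply: le_trans L1 _; rewrite lee_fin ge_min lexx orbT.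
have L1d : (L1norm a b (fun t => w t - v t)%R <= delta%:E)%E.
  by apply: le_trans L1 _; rewrite lee_fin ge_min lexx.
have [El Er] := H eps w eps01 (And3 wH1 L1d Ew) i.
have [ha hb] := ends i.
have sub := @subset_ball i r rr0.
have E00 : 0 < K * eps `^ kappa by rewrite mulr_gt0// powR_gt0.
have ar : a < h i - r by lra.
have rb : h i + r < b by lra.
have L1J (A : set R) s' : A `<=` `](h i - r), (h i + r)[ ->
    (forall t, A t -> v t = s') ->
    (\int[mu]_(t in A) `|w t - s'|%:E <= (r / 8)%:E)%E.
  move=> Ai vs; apply: le_trans L1r.
  have -> : (\int[mu]_(t in A) `|w t - s'|%:E = \int[mu]_(t in A) `|w t - v t|%:E)%E.
    by apply: eq_integral => t /set_mem At; rewrite vs.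
  apply: ge0_integral_subset => [t _|t /Ai/sub//].
  by rewrite lee_fin.
have L1l : (\int[mu]_(t in `](h i - r)%R, (h i - r / 2)%R[) `|w t - sg i|%:E
    <= (r / 8)%:E)%E.
  apply: L1J => [|t]; first by apply: subset_itv; rewrite bnd_simp; lra.
  rewrite /= in_itv/= => /andP[t1 t2]; apply: (vsg i t).1.
  by apply/andP; split; lra.
have L1rr : (\int[mu]_(t in `](h i + r / 2)%R, (h i + r)%R[) `|w t + sg i|%:E
    <= (r / 8)%:E)%E.
  under eq_integral do rewrite -[X in _ + X]opprK.
  apply: L1J => [|t]; first by apply: subset_itv; rewrite bnd_simp; lra.
  rewrite /= in_itv/= => /andP[t1 t2]; apply: (vsg i t).2.
  by apply/andP; split; lra.
have := local_transition p1 n0 (wderivP wH1) e0 r_0 ar rb (sg1 i) E00 L1l L1rr El Er.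
apply: le_trans; rewrite lee_fin lerD2l lerN2.
have kl : eps `^ kappa * eps = eps `^ (kappa + 1).
  rewrite powRD ?powRr1 ?(ltW e0)//; apply/implyP => _; exact: lt0r_neq0.
have -> : 16 * n / r * (K * eps `^ kappa * eps) = 16 * n / r * K * eps `^ (kappa + 1).
  by rewrite -kl; ring.
have nr : 0 <= 16 * n / r * K by rewrite !mulr_ge0 ?invr_ge0// ltW.
rewrite (powRM _ nr (powR_ge0 _ _)) -powRrM [(kappa + 1) * _]mulrC -/alpha.
rewrite -subr_ge0 [X in 0 <= X](_ : _ = eps `^ (alpha * (kappa + 1))) ?powR_ge0//.
ring.
Qed.

(** Apply the hypothesis at radius r/2: the balls are disjoint from each
    other and from the annuli of radius r, so what they carry is subtracted
    from the upper bound on the total energy. *)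
Lemma annuli_of_balls kappa lambda : kappa <= lambda ->
  balls_bound kappa lambda -> annuli_bound lambda.
Proof.
move=> kl bal r rr0; move/andP: (rr0) => [r_0 r_r0].
have r2 : 0 < r / 2 <= r0 by apply/andP; split; lra.
have [delta [C [d0 C0 H]]] := bal _ r2.
exists delta, (1 + N%:R * C); split => //.
  by rewrite ltr_pwDl// mulr_ge0// ltW.
move=> eps w eps01 [wH1 L1 Ew] i; have /andP[e0 e1] := eps01.
have adm : nearly_optimal delta kappa eps w.
  split => //; apply: le_trans Ew _; rewrite lee_fin lerD2l.
  by apply: ger_powR => //; rewrite e0 ltW.
have Hj j := H eps w eps01 adm j.
have Hsum : ((N%:R * (cp - C * eps `^ lambda))%:E <= \sum_(j < N)
    \int[mu]_(t in `](h j - r / 2)%R, (h j + r / 2)%R[) (dens eps w t)%:E)%E.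
  apply: le_trans (_ : (_ <= \sum_(j < N) (cp - C * eps `^ lambda)%:E)%E) _; last first.
    exact: lee_sum.
  by rewrite sumEFin sumr_const card_ord mulr_natl.
have key (A : set R) : measurable A -> A `<=` `](h i - r), (h i + r)[ ->
    A `&` `](h i - r / 2), (h i + r / 2)[ = set0 ->
    (\int[mu]_(t in A) (dens eps w t)%:E <= ((1 + N%:R * C) * eps `^ lambda)%:E)%E.
  move=> mA Ai Ai0.
  have := @ge0_integral_disjoint_sum R N `]a, b[%classic A
    (fun j => `](h j - r / 2), (h j + r / 2)[%classic) (fun t => (dens eps w t)%:E)
    (measurable_itv _) mA (fun j => measurable_itv _) (measurable_dens eps wH1).
  have de0 t : `]a, b[%classic t -> (0 <= (dens eps w t)%:E)%E.
    by move=> _; rewrite lee_fin dens_ge0.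
  have Aab : A `<=` `]a, b[ by apply: subset_trans Ai _; exact: subset_ball.
  move=> /(_ de0 Aab (fun j => @subset_ball j _ r2)) tot.
  have {}tot : (\int[mu]_(t in A) (dens eps w t)%:E +
      (N%:R * (cp - C * eps `^ lambda))%:E <= (N%:R * cp + eps `^ lambda)%:E)%E.
    apply: le_trans Ew; apply: le_trans (tot _ _).
    - exact: leeD.
    - move=> j; have [<-//|ij] := eqVneq i j.
      rewrite -subset0 => t [/Ai ti tj].
      have := balls_disjoint r_r0 ij; rewrite -subset0 => /(_ t); apply; split => //.
      by move: tj; apply: subset_itv; rewrite bnd_simp; lra.
    - by move=> i' j'; apply: balls_disjoint; lra.
  rewrite -leeBrDr// -EFinB in tot; apply: le_trans tot _.
  by rewrite lee_fin; lra.
split; apply: key => //.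
- by apply: subset_itv; rewrite bnd_simp; lra.
- rewrite -subset0 => t [/=]; rewrite !in_itv/= => /andP[t1 t2] /andP[t3 t4]; lra.
- by apply: subset_itv; rewrite bnd_simp; lra.
- rewrite -subset0 => t [/=]; rewrite !in_itv/= => /andP[t1 t2] /andP[t3 t4]; lra.
Qed.

Lemma energy_of_balls kappa lambda : balls_bound kappa lambda ->
  exists delta C, [/\ 0 < delta, 0 < C & forall eps w, 0 < eps < 1 ->
    nearly_optimal delta kappa eps w ->
    ((N%:R * cp - C * eps `^ lambda)%R%:E <= energy a b p F eps w)%E].
Proof.
have r00' : 0 < r0 <= r0 by rewrite r00 lexx.
move=> /(_ _ r00')[delta [C [d0 C0 H]]].
exists delta, (N%:R * C + 1); split => //; first by rewrite ltr_wpDl// mulr_ge0// ltW.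
move=> eps w eps01 adm; have [wH1 _ _] := adm; have /andP[e0 _] := eps01.
have := @ge0_integral_disjoint_sum R N `]a, b[%classic set0
  (fun j => `](h j - r0), (h j + r0)[%classic) (fun t => (dens eps w t)%:E)
  (measurable_itv _) measurable0 (fun j => measurable_itv _) (measurable_dens eps wH1).
rewrite integral_set0 add0e => tot.
apply: le_trans (tot _ _ _ _ _).
- apply: le_trans (_ : (_ <= \sum_(j < N) (cp - C * eps `^ lambda)%:E)%E) _; last first.
    by apply: lee_sum => j _; exact: H.
  rewrite sumEFin sumr_const card_ord lee_fin -[leRHS]mulr_natl.
  by have := powR_ge0 eps lambda; lra.
- by move=> t _; rewrite lee_fin dens_ge0.
- exact: sub0set.
- by move=> j; exact: subset_ball.
- by move=> j; rewrite set0I.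
- by move=> i j; exact: balls_disjoint.
Qed.

End Bootstrap.

Theorem proposition1 (R : realType) (a b : R) (hab : a < b)
    (p n : R) (hp : 1 < p) (hpn : p < n)
    (N : nat) (h : 'I_N -> R) (v : R -> R)
    (hv : pm1_step_function a b h v)
    (k : nat -> R)
    (hk1 : k 1%N = 0)
    (hk2 : k 2%N = (p - 1) / p + n^-1)
    (hk : forall m : nat, (2 <= m)%N ->
       k m.+1 = ((p - 1) / p + n^-1) * (k m + 1))
    (m : nat) (hm : (1 <= m)%N) :
  exists delta C : R, [/\ 0 < delta, 0 < C &
    \forall eps \near (0 : R)^'+, forall w : R -> R, H1 a b w ->
      (L1norm a b (fun x => w x - v x)%R <= delta%:E)%E ->
      (energy a b p (potential n) eps w <=
         (N%:R * transition_cost p (potential n) + eps `^ k m)%R%:E)%E ->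
      ((N%:R * transition_cost p (potential n) - C * eps `^ k m.+1)%R%:E <=
         energy a b p (potential n) eps w)%E].

Proof.
have [r0 [sg [r00 ends gaps sg1 vsg]]] := pm1_step_function_isolated_jumps hv.
have n0 : 0 < n by lra.
have al0 : 0 < (p - 1) / p + n^-1.
  by rewrite addr_gt0 ?invr_gt0 ?divr_gt0//; lra.
(* The recursion also holds from k 1 to k 2, because k 1 = 0. *)
have kS j : (1 <= j)%N -> k j.+1 = ((p - 1) / p + n^-1) * (k j + 1).
  by case: j => [//|[_|j _]]; [rewrite hk1 hk2 add0r mulr1|exact: hk].
have kmono j : (1 <= j)%N -> k j <= k j.+1.
  elim: j => [//|[_ _|j IH _]]; first by rewrite hk1 hk2 ltW.
  by rewrite kS// [leRHS]kS// ler_pM2l// lerD2r IH.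
have ann j : (1 <= j)%N -> annuli_bound a b p n h v r0 (k j).
  elim: j => [//|[_ _|j IH _]].
    by rewrite hk1; exact: annuli_bound0.
  apply: (annuli_of_balls hp n0 ends gaps (kmono j.+1 isT)).
  rewrite (kS j.+1 isT); apply: (balls_of_annuli hp n0 ends sg1 vsg); exact: IH.
have := balls_of_annuli hp n0 ends sg1 vsg (ann m hm); rewrite -kS//.
move=> /(energy_of_balls hp n0 r00 ends gaps)[delta [C [d0 C0 H]]].
exists delta, C; split => //; near=> eps => w wH1 wL1 wE; apply: H => //.
apply/andP; split; near: eps; [exact: nbhs_right_gt|exact: nbhs_right_lt].
Unshelve. all: by end_near.
Qed.
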